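(* Let $\mathcal{D}$ be a definite quaternion algebra over $\mathbb{Q}$ and let $G$ be an imprimitive absolutely irreducible maximal finite subgroup of $GL_2(\mathcal{D})$. Then either $\mathcal{D}=D_{2,\infty}$ and $G\cong (SL_2(\mathbb{F}_3))^2\rtimes\mathrm{Sym}_2$, or $\mathcal{D}=D_{3,\infty}$ and $G\cong(\mathrm{Dic}_{12})^2\rtimes\mathrm{Sym}_2$.
   Context: $D_{p,\infty}$ denotes the quaternion algebra over $\mathbb{Q}$ ramified exactly at $p$ and $\infty$. A finite subgroup $G\le GL_2(\mathcal{D})$ is absolutely irreducible if its $\mathbb{Q}$-span in $M_2(\mathcal{D})$ equals $M_2(\mathcal{D})$; it is a maximal finite subgroup if it is not properly contained in a finite subgroup of $GL_2(\mathcal{D})$. Writing $V=\mathcal{D}^{1\times 2}$ as a $\mathcal{D}$-$G$-bimodule (with $\mathcal{D}$ acting on the left, $G$ on the right), an irreducible $G$ is imprimitive if $V=V_1\oplus\cdots\oplus V_s$ nontrivially as left $\mathcal{D}$-modules with $G$ permuting the $V_i$. $\mathrm{Dic}_{12}=\langle a,b\mid a^6=1,b^2=a^3,bab^{-1}=a^{-1}\rangle$; the semidirect products are the wreath products with $\mathrm{Sym}_2$ permuting the two factors. *)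

(* Defs.v *)
From HB Require Import structures.
From mathcomp Require Import boolp classical_sets functions.
From mathcomp Require Import all_boot all_order all_algebra.
From mathcomp Require Import all_fingroup all_solvable all_field.
From mathcomp Require Import finmap.
From mathcomp Require Import ring lra.

Set Implicit Arguments.
Unset Strict Implicit.
Unset Printing Implicit Defensive.

Import Order.TTheory GRing.Theory Num.Theory.
Local Open Scope ring_scope.

Section ScalarExtension.

Variables (F L : fieldType).

(* L (x)_F A, in coordinates with respect to the F-basis vbasis {:A} of A; iota
   only matters for the product. *)
Definition scalar_ext (iota : {rmorphism F -> L}) (A : falgType F) :=
  'rV[L]_(\dim {:A}).

HB.instance Definition _ iota A := GRing.Lmodule.on (scalar_ext iota A).

Variables (iota : {rmorphism F -> L}) (A : falgType F).

Local Notation E := (scalar_ext iota A).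

Let b := vbasis {:A}.

(* a |-> 1 (x) a *)
Definition scalar_ext_in (a : A) : E := \row_k iota (coord b k a).

Definition scalar_ext_mul (x y : E) : E :=
  \sum_i \sum_j (x ord0 i * y ord0 j) *: scalar_ext_in (b`_i * b`_j).

Local Notation e := scalar_ext_in.
Local Notation m := scalar_ext_mul.

Lemma scalar_ext_inD : {morph e : u v / u + v}.
Proof. by move=> u v; apply/rowP => k; rewrite !mxE linearD rmorphD. Qed.

Lemma scalar_ext_in0 : e 0 = 0.
Proof. by apply/rowP => k; rewrite !mxE linear0 rmorph0. Qed.

Lemma scalar_ext_inZ c u : e (c *: u) = iota c *: e u.
Proof. by apply/rowP => k; rewrite !mxE linearZ rmorphM. Qed.

Lemma scalar_ext_in_sum I r (P : pred I) (f : I -> A) :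
  e (\sum_(i <- r | P i) f i) = \sum_(i <- r | P i) e (f i).
Proof. exact: (big_morph e scalar_ext_inD scalar_ext_in0). Qed.

Lemma scalar_ext_expand (x : E) : x = \sum_i x ord0 i *: e b`_i.
Proof.
apply/rowP => k; rewrite summxE (bigD1 k) //= !mxE.
rewrite coord_free ?(basis_free (vbasisP _)) // eqxx rmorph1 mulr1.
rewrite big1 ?addr0 // => i ik; rewrite !mxE coord_free ?(basis_free (vbasisP _)) //.
move: ik; rewrite -val_eqE /= => /negbTE ->.
by rewrite rmorph0 mulr0.
Qed.

Lemma scalar_ext_mulDl : left_distributive m +%R.
Proof.
move=> x y z; rewrite /m -big_split; apply: eq_bigr => i _ /=.
rewrite -big_split; apply: eq_bigr => j _ /=.
by rewrite mxE mulrDl scalerDl.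
Qed.

Lemma scalar_ext_mulDr : right_distributive m +%R.
Proof.
move=> x y z; rewrite /m -big_split; apply: eq_bigr => i _ /=.
rewrite -big_split; apply: eq_bigr => j _ /=.
by rewrite mxE mulrDr scalerDl.
Qed.

Lemma scalar_ext_mulZl c x y : m (c *: x) y = c *: m x y.
Proof.
rewrite /m scaler_sumr; apply: eq_bigr => i _; rewrite scaler_sumr.
by apply: eq_bigr => j _; rewrite mxE scalerA mulrA.
Qed.

Lemma scalar_ext_mulZr c x y : m x (c *: y) = c *: m x y.
Proof.
rewrite /m scaler_sumr; apply: eq_bigr => i _; rewrite scaler_sumr.
by apply: eq_bigr => j _; rewrite mxE scalerA mulrCA.
Qed.

Lemma scalar_ext_mul0l x : m 0 x = 0.
Proof. by have := scalar_ext_mulZl 0 0 x; rewrite !scale0r. Qed.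

Lemma scalar_ext_mul0r x : m x 0 = 0.
Proof. by have := scalar_ext_mulZr 0 x 0; rewrite !scale0r. Qed.

Lemma scalar_ext_suml I r (P : pred I) (f : I -> E) y :
  m (\sum_(i <- r | P i) f i) y = \sum_(i <- r | P i) m (f i) y.
Proof.
exact: (big_morph (fun u => m u y) (fun u v => scalar_ext_mulDl u v y)
  (scalar_ext_mul0l y)).
Qed.

Lemma scalar_ext_sumr I r (P : pred I) (f : I -> E) x :
  m x (\sum_(i <- r | P i) f i) = \sum_(i <- r | P i) m x (f i).
Proof.
exact: (big_morph (m x) (scalar_ext_mulDr x) (scalar_ext_mul0r x)).
Qed.

Lemma scalar_ext_inM u v : m (e u) (e v) = e (u * v).
Proof.
rewrite [in RHS](coord_vbasis (memvf u)) [in RHS](coord_vbasis (memvf v)).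
rewrite mulr_suml scalar_ext_in_sum; apply: eq_bigr => i _.
rewrite mulr_sumr scalar_ext_in_sum; apply: eq_bigr => j _.
by rewrite !mxE -scalerAl -scalerAr !scalar_ext_inZ scalerA.
Qed.

Lemma scalar_ext_mulA : associative m.
Proof.
have A2 u v z : m (e u) (m (e v) z) = m (m (e u) (e v)) z.
  rewrite (scalar_ext_expand z) (scalar_ext_sumr _ _ _ (e v)) !scalar_ext_sumr.
  apply: eq_bigr => k _.
  by rewrite !scalar_ext_mulZr !scalar_ext_inM mulrA.
have A1 u y z : m (e u) (m y z) = m (m (e u) y) z.
  rewrite (scalar_ext_expand y) scalar_ext_suml scalar_ext_sumr.
  rewrite (scalar_ext_sumr _ _ _ (e u)) scalar_ext_suml.
  apply: eq_bigr => j _.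
  by rewrite scalar_ext_mulZl !scalar_ext_mulZr scalar_ext_mulZl A2.
move=> x y z; rewrite (scalar_ext_expand x) [LHS]scalar_ext_suml.
rewrite (scalar_ext_suml _ _ _ y) [RHS]scalar_ext_suml.
by apply: eq_bigr => i _; rewrite !scalar_ext_mulZl A1.
Qed.

Lemma scalar_ext_mul1r : left_id (e 1) m.
Proof.
move=> x; rewrite (scalar_ext_expand x) scalar_ext_sumr.
by apply: eq_bigr => i _; rewrite scalar_ext_mulZr scalar_ext_inM mul1r.
Qed.

Lemma scalar_ext_mulr1 : right_id (e 1) m.
Proof.
move=> x; rewrite (scalar_ext_expand x) scalar_ext_suml.
by apply: eq_bigr => i _; rewrite scalar_ext_mulZl scalar_ext_inM mulr1.
Qed.

HB.instance Definition _ := GRing.Zmodule_isPzRing.Build E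
  scalar_ext_mulA scalar_ext_mul1r scalar_ext_mulr1
  scalar_ext_mulDl scalar_ext_mulDr.

End ScalarExtension.

Definition division_ring (R : pzRingType) : Prop :=
  (1 : R) != 0 /\ forall x : R, x != 0 -> exists y, y * x = 1 /\ x * y = 1.

Record absval := AbsVal {
  absval_fun :> rat -> rat;
  absval_ge0 : forall x, 0 <= absval_fun x;
  absval_eq0 : forall x, (absval_fun x == 0) = (x == 0);
  absvalM : {morph absval_fun : x y / x * y};
  ler_absvalD : forall x y, absval_fun (x + y) <= absval_fun x + absval_fun y
}.

Section Completion.

Variable nu : absval.

Definition cauchy_seq (u : nat -> rat) : Prop :=
  forall eps : rat, 0 < eps ->
  exists N, forall i j, (N <= i)%N -> (N <= j)%N -> nu (u i - u j) < eps.

Definition null_seq (u : nat -> rat) : Prop :=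
  forall eps : rat, 0 < eps -> exists N, forall i, (N <= i)%N -> nu (u i) < eps.

Lemma absval0 : nu 0 = 0.
Proof. by apply/eqP; rewrite absval_eq0. Qed.

Lemma absval1 : nu 1 = 1.
Proof.
have n1 : nu 1 != 0 by rewrite absval_eq0 oner_eq0.
by apply: (mulfI n1); rewrite -absvalM !mulr1.
Qed.

Lemma absvalN x : nu (- x) = nu x.
Proof.
suff E : nu (- 1) = 1 by rewrite -mulN1r absvalM E mul1r.
apply/eqP; rewrite -(@pexpr_eq1 _ _ 2) ?absval_ge0 //.
by rewrite expr2 -absvalM mulrNN mulr1 absval1.
Qed.

Lemma absvalB x y : nu (x - y) <= nu x + nu y.
Proof. by rewrite -(absvalN y) ler_absvalD. Qed.

Lemma absvalV x : nu x^-1 = (nu x)^-1.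
Proof.
have [->|x0] := eqVneq x 0; first by rewrite invr0 absval0 invr0.
have n0 : nu x != 0 by rewrite absval_eq0.
by apply: (mulfI n0); rewrite -absvalM !mulfV ?absval1.
Qed.

Lemma cauchy_cst c : cauchy_seq (fun=> c).
Proof. by move=> e e0; exists 0%N => i j _ _; rewrite subrr absval0. Qed.

Lemma cauchyB u v :
  cauchy_seq u -> cauchy_seq v -> cauchy_seq (fun n => u n - v n).
Proof.
move=> cu cv e e0; have e20 : 0 < e / 2 by lra.
have [N HN] := cu _ e20; have [M HM] := cv _ e20.
exists (maxn N M) => i j; rewrite !geq_max => /andP[Ni Mi] /andP[Nj Mj].
have -> : u i - v i - (u j - v j) = (u i - u j) - (v i - v j) by ring.
apply: le_lt_trans (absvalB _ _) _.
by have := HN i j Ni Nj; have := HM i j Mi Mj; lra.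
Qed.

Lemma cauchy_bounded u :
  cauchy_seq u -> exists2 B, 0 < B & forall n, nu (u n) <= B.
Proof.
move=> cu; have [N HN] := cu 1 ltr01.
exists (1 + nu (u N) + \sum_(i < N) nu (u i)).
  have := absval_ge0 nu (u N).
  have := @sumr_ge0 _ _ (index_enum 'I_N) xpredT (fun i => nu (u i))
     (fun i _ => absval_ge0 nu _); lra.
move=> n; have [nN|Nn] := ltnP n N.
  rewrite (bigD1 (Ordinal nN)) //=.
  have := absval_ge0 nu (u N).
  have := @sumr_ge0 _ _ (index_enum 'I_N) (fun i => i != Ordinal nN)
     (fun i => nu (u i)) (fun i _ => absval_ge0 nu _); lra.
have := @sumr_ge0 _ _ (index_enum 'I_N) xpredT (fun i => nu (u i))
     (fun i _ => absval_ge0 nu _).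
have := HN n N Nn (leqnn _).
have := ler_absvalD nu (u n - u N) (u N).
by rewrite subrK; lra.
Qed.

Lemma cauchyM u v :
  cauchy_seq u -> cauchy_seq v -> cauchy_seq (fun n => u n * v n).
Proof.
move=> cu cv e e0.
have [B B0 HB] := cauchy_bounded cu; have [C C0 HC] := cauchy_bounded cv.
have eC : 0 < e / (2 * C) by rewrite divr_gt0 // mulr_gt0.
have eB : 0 < e / (2 * B) by rewrite divr_gt0 // mulr_gt0.
have [N HN] := cu _ eC; have [M HM] := cv _ eB.
exists (maxn N M) => i j; rewrite !geq_max => /andP[Ni Mi] /andP[Nj Mj].
have -> : u i * v i - u j * v j = (u i - u j) * v i + u j * (v i - v j) by ring.
apply: le_lt_trans (ler_absvalD _ _ _) _; rewrite !absvalM.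
have h1 : nu (u i - u j) * nu (v i) <= nu (u i - u j) * C.
  by rewrite ler_wpM2l ?absval_ge0.
have h2 : nu (u j) * nu (v i - v j) <= B * nu (v i - v j).
  by rewrite ler_wpM2r ?absval_ge0.
have h3 : nu (u i - u j) * C < e / 2.
  have := HN i j Ni Nj; rewrite ltr_pdivlMr ?mulr_gt0 //; lra.
have h4 : B * nu (v i - v j) < e / 2.
  have := HM i j Mi Mj; rewrite ltr_pdivlMr ?mulr_gt0 //; lra.
lra.
Qed.

Definition cauchy_pred : {pred nat -> rat} := fun u => `[< cauchy_seq u >].

Lemma cauchy_subring_closed : subring_closed cauchy_pred.
Proof.
split=> [|u v /asboolP cu /asboolP cv|u v /asboolP cu /asboolP cv]; apply/asboolP.
- exact: cauchy_cst.
- exact: cauchyB.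
- exact: cauchyM.
Qed.

HB.instance Definition _ :=
  GRing.isSubringClosed.Build (nat -> rat) cauchy_pred cauchy_subring_closed.

Record cauchy_ring :=
  CauchySeq { cauchy_val :> nat -> rat; _ : cauchy_val \in cauchy_pred }.

HB.instance Definition _ := [isSub for cauchy_val].
HB.instance Definition _ := [Choice of cauchy_ring by <:].
HB.instance Definition _ := [SubChoice_isSubComNzRing of cauchy_ring by <:].

Definition null_pred : {pred cauchy_ring} := fun u => `[< null_seq u >].

Lemma cauchy_valP (u : cauchy_ring) : cauchy_seq u.
Proof. by apply/asboolP; exact: (valP u). Qed.

Lemma null_idealr_closed : idealr_closed null_pred.
Proof.
split.
- by apply/asboolP => e e0; exists 0%N => i _; rewrite absval0.
- apply/negP => /asboolP /(_ 1 ltr01) [N /(_ N (leqnn _))].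
  by rewrite absval1 ltxx.
move=> a u v /asboolP nu_u /asboolP nu_v; apply/asboolP => e e0.
have [B B0 HB] := cauchy_bounded (cauchy_valP a).
have eB : 0 < e / (2 * B) by rewrite divr_gt0 // mulr_gt0.
have e20 : 0 < e / 2 by lra.
have [N HN] := nu_u _ eB; have [M HM] := nu_v _ e20.
exists (maxn N M) => i; rewrite !geq_max => /andP[Ni Mi].
apply: le_lt_trans (ler_absvalD _ _ _) _; rewrite absvalM.
have h2 : nu (a i) * nu (u i) <= B * nu (u i).
  by rewrite ler_wpM2r ?absval_ge0.
have h4 : B * nu (u i) < e / 2.
  have := HN i Ni; rewrite ltr_pdivlMr ?mulr_gt0 //; lra.
have := HM i Mi; lra.
Qed.

HB.instance Definition _ := isIdealr.Build cauchy_ring null_pred null_idealr_closed.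

(* The completion of rat at nu: Cauchy sequences modulo null sequences. *)
Definition completion := {ideal_quot null_pred}.

HB.instance Definition _ := GRing.ComNzRing.on completion.

Lemma cauchy_inv (u : cauchy_ring) : ~ null_seq u ->
  exists v : cauchy_ring, null_seq (fun n => v n * u n - 1).
Proof.
move=> nn.
have [d d0 [N HN]] : exists2 d, 0 < d &
    exists N, forall n, (N <= n)%N -> d <= nu (u n).
  apply: contrapT => H; apply: nn => e e0.
  have e20 : 0 < e / 2 by lra.
  have [N HN] := cauchy_valP u e20.
  exists N => i Ni; apply: contrapT => /negP; rewrite -leNgt => ei.
  apply: H; exists (e / 2) => //; exists N => n Nn.
  have := HN i n Ni Nn.
  have := ler_absvalD nu (u i - u n) (u n); rewrite subrK; lra.
have cv : cauchy_seq (fun n => (u n)^-1).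
  move=> e e0; have ed : 0 < e * d ^+ 2 by rewrite mulr_gt0 ?exprn_gt0.
  have [M HM] := cauchy_valP u ed.
  exists (maxn N M) => i j; rewrite !geq_max => /andP[Ni Mi] /andP[Nj Mj].
  have ui := HN _ Ni; have uj := HN _ Nj.
  have ui0 : u i != 0 by rewrite -(absval_eq0 nu); apply/eqP; lra.
  have uj0 : u j != 0 by rewrite -(absval_eq0 nu); apply/eqP; lra.
  have -> : (u i)^-1 - (u j)^-1 = (u j - u i) * ((u i)^-1 * (u j)^-1).
    by field; rewrite ui0 uj0.
  rewrite !absvalM !absvalV -invfM ltr_pdivrMr; last by rewrite mulr_gt0 //; lra.
  apply: lt_le_trans (HM j i Mj Mi) _.
  by rewrite ler_pM2l // expr2 ler_pM // ltW.
have cvP : (fun n => (u n)^-1) \in cauchy_pred by apply/asboolP.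
exists (CauchySeq cvP) => e e0; exists N => i Ni /=.
have ui := HN _ Ni.
have ui0 : u i != 0 by rewrite -(absval_eq0 nu); apply/eqP; lra.
by rewrite mulVf // subrr absval0.
Qed.

Lemma completion_inv_ex (x : completion) : x != 0 -> exists y, y * x = 1.
Proof.
elim/quotW: x => u x0.
have nn : ~ null_seq u.
  move=> nu_u; move/eqP: x0; apply.
  rewrite -[0](@rmorph0 _ _ (\pi_completion)%qT); apply/eqP.
  by rewrite -Quotient.idealrBE subr0; apply/asboolP.
have [v Hv] := cauchy_inv nn; exists (\pi_completion v)%qT.
rewrite -rmorphM -[1](@rmorph1 _ _ (\pi_completion)%qT); apply/eqP.
by rewrite -Quotient.idealrBE; apply/asboolP.
Qed.

Definition completion_inv (x : completion) : completion :=
  if pselect (x != 0) is left x0 then projT1 (cid (completion_inv_ex x0)) else 0.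

Lemma completion_mulVf x : x != 0 -> completion_inv x * x = 1.
Proof.
move=> x0; rewrite /completion_inv; case: pselect => // x0'.
by case: cid.
Qed.

Lemma completion_invr0 : completion_inv 0 = 0.
Proof. by rewrite /completion_inv; case: pselect => // a; case/eqP: (a). Qed.

HB.instance Definition _ := GRing.ComNzRing_isField.Build completion
  completion_mulVf completion_invr0.

Lemma cauchy_cstP (c : rat) : (fun=> c) \in cauchy_pred.
Proof. by apply/asboolP; exact: cauchy_cst. Qed.

Definition to_completion (c : rat) : completion :=
  (\pi_completion (CauchySeq (cauchy_cstP c)))%qT.

Lemma to_completion_zmod : zmod_morphism to_completion.
Proof. by move=> x y; rewrite /to_completion -rmorphB; congr (\pi _)%qT; apply: val_inj. Qed.

Lemma to_completion_monoid : monoid_morphism to_completion.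
Proof.
split=> [|x y]; first by rewrite -[RHS](@rmorph1 _ _ (\pi_completion)%qT);
  congr (\pi _)%qT; apply: val_inj.
by rewrite /to_completion -rmorphM; congr (\pi _)%qT; apply: val_inj.
Qed.

HB.instance Definition _ :=
  GRing.isZmodMorphism.Build rat completion to_completion to_completion_zmod.
HB.instance Definition _ :=
  GRing.isMonoidMorphism.Build rat completion to_completion to_completion_monoid.

End Completion.

(* p ^ (- v_p(x)) *)
Definition padic_abs (p : nat) (x : rat) : rat :=
  if x == 0 then 0
  else p%:R ^+ logn p `|denq x|%N / p%:R ^+ logn p `|numq x|%N.

Section PadicAbs.

Variables (p : nat) (p_pr : prime p).

Let p_gt0 : 0 < p%:R :> rat.
Proof. by rewrite ltr0n prime_gt0. Qed.

Let pX_gt0 n : 0 < p%:R ^+ n :> rat.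
Proof. by rewrite exprn_gt0. Qed.

Let pX_neq0 n : p%:R ^+ n != 0 :> rat.
Proof. by rewrite lt0r_neq0. Qed.

Lemma padic_abs_ge0 x : 0 <= padic_abs p x.
Proof. by rewrite /padic_abs; case: eqP => // _; rewrite ltW // divr_gt0. Qed.

Lemma padic_abs_eq0 x : (padic_abs p x == 0) = (x == 0).
Proof.
rewrite /padic_abs; have [//|_] := eqVneq x 0.
by rewrite mulf_eq0 invr_eq0 !(negbTE (pX_neq0 _)).
Qed.

Lemma padic_abs_frac (a b : int) : a != 0 -> b != 0 ->
  padic_abs p (a%:~R / b%:~R) = p%:R ^+ logn p `|b|%N / p%:R ^+ logn p `|a|%N.
Proof.
move=> a0 b0; have [x xE] : exists x : rat, x = a%:~R / b%:~R by eexists.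
have x0 : x != 0 by rewrite xE mulf_neq0 ?invr_eq0 ?intr_eq0.
rewrite -xE.
rewrite /padic_abs (negbTE x0).
have E : numq x * b = a * denq x.
  apply: (@intr_inj rat); rewrite !intrM numqE xE.
  by field; rewrite intr_eq0.
have n0 : numq x != 0 by rewrite numq_eq0.
have d0 := denq_neq0 x.
have : logn p `|(numq x * b)%R|%N = logn p `|(a * denq x)%R|%N by rewrite E.
rewrite !abszM !lognM ?absz_gt0 // => H.
by apply/eqP; rewrite eqr_div // -!exprD addnC -H addnC.
Qed.

Lemma padic_absM : {morph padic_abs p : x y / x * y}.
Proof.
move=> x y; have [->|x0] := eqVneq x 0.
  by rewrite mul0r /padic_abs eqxx mul0r.
have [->|y0] := eqVneq y 0; first by rewrite mulr0 /padic_abs eqxx mulr0.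
have -> : x * y = (numq x * numq y)%:~R / (denq x * denq y)%:~R.
  by rewrite !intrM -{1}(divq_num_den x) -{1}(divq_num_den y) mulf_div.
rewrite padic_abs_frac ?mulf_neq0 ?numq_eq0 ?denq_neq0 //.
rewrite /padic_abs (negbTE x0) (negbTE y0).
by rewrite !abszM !lognM ?absz_gt0 ?numq_eq0 ?denq_neq0 // !exprD mulf_div.
Qed.

Lemma padic_absD x y : padic_abs p (x + y) <= padic_abs p x + padic_abs p y.
Proof.
have [->|x0] := eqVneq x 0; first by rewrite add0r lerDr padic_abs_ge0.
have [->|y0] := eqVneq y 0; first by rewrite addr0 lerDl padic_abs_ge0.
have [->|s0] := eqVneq (x + y) 0.
  by rewrite {1}/padic_abs eqxx addr_ge0 ?padic_abs_ge0.
set d := denq x * denq y; set a := numq x * denq y; set b := numq y * denq x.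
have d0 : d != 0 by rewrite mulf_neq0 ?denq_neq0.
have a0 : a != 0 by rewrite mulf_neq0 ?numq_eq0 ?denq_neq0.
have b0 : b != 0 by rewrite mulf_neq0 ?numq_eq0 ?denq_neq0.
have dx : (denq x)%:~R != 0 :> rat by rewrite intr_eq0 denq_neq0.
have dy : (denq y)%:~R != 0 :> rat by rewrite intr_eq0 denq_neq0.
have Ex : x = a%:~R / d%:~R.
  by rewrite /a /d !intrM numqE; field; rewrite dx dy.
have Ey : y = b%:~R / d%:~R.
  by rewrite /b /d !intrM numqE; field; rewrite dx dy.
have Es : x + y = (a + b)%:~R / d%:~R by rewrite {1}Ex {1}Ey intrD mulrDl.
have ab0 : a + b != 0.
  by apply: contraNneq s0 => E; rewrite Es E mul0r.
rewrite Es {1}Ex {1}Ey !padic_abs_frac // -mulrDr ler_pM2l //.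
set n := minn (logn p `|a|%N) (logn p `|b|%N).
have pn c : c != 0 -> (n <= logn p `|c|%N)%N -> ((p ^ n)%N %| c)%Z.
  by move=> c0 nc; rewrite dvdzE /= pfactor_dvdn ?absz_gt0.
have na : (n <= logn p `|(a + b)%R|%N)%N.
  rewrite -pfactor_dvdn ?absz_gt0 //.
  have : ((p ^ n)%N %| a + b)%Z.
    by rewrite rpredD // pn // ?geq_minl ?geq_minr.
  by rewrite dvdzE.
have h : (p%:R ^+ logn p `|(a + b)%R|%N)^-1 <= (p%:R ^+ n)^-1 :> rat.
  by rewrite lef_pV2 ?posrE // ler_weXn2l // ler1n prime_gt0.
apply: le_trans h _; rewrite /n.
have ia : 0 < (p%:R ^+ logn p `|a|%N)^-1 :> rat by rewrite invr_gt0.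
have ib : 0 < (p%:R ^+ logn p `|b|%N)^-1 :> rat by rewrite invr_gt0.
by case: leqP => _; lra.
Qed.

Definition padic_absval : absval :=
  AbsVal padic_abs_ge0 padic_abs_eq0 padic_absM padic_absD.

End PadicAbs.

Lemma rat_norm_ge0 (x : rat) : 0 <= `|x|. Proof. exact: normr_ge0. Qed.
Lemma rat_norm_eq0 (x : rat) : (`|x| == 0) = (x == 0). Proof. exact: normr_eq0. Qed.
Lemma rat_normM : {morph Num.norm : x y / x * y : rat}. Proof. exact: normrM. Qed.
Lemma rat_normD (x y : rat) : `|x + y| <= `|x| + `|y|. Proof. exact: ler_normD. Qed.

Definition archimedean_absval : absval :=
  AbsVal rat_norm_ge0 rat_norm_eq0 rat_normM rat_normD.

Inductive place :=
  | FinitePlace (p : nat) of prime p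
  | InfinitePlace.

Definition place_absval (v : place) : absval :=
  match v with
  | FinitePlace p p_pr => padic_absval p_pr
  | InfinitePlace => archimedean_absval
  end.

(* D (x) Q_v *)
Definition localization (D : falgType rat) (v : place) : pzRingType :=
  scalar_ext (@to_completion (place_absval v) : {rmorphism rat -> _}) D.

(* The definition is meant for F of characteristic different from 2. *)
Definition quaternion_algebra (F : fieldType) (D : falgType F) : Prop :=
  exists (a b : F) (i j : D),
    [/\ a != 0, b != 0, i ^+ 2 = a%:A, j ^+ 2 = b%:A & j * i = - (i * j)] /\
    basis_of {:D} [:: 1; i; j; i * j].

Definition ramified (D : falgType rat) (v : place) : Prop :=
  division_ring (localization D v).

Definition definite_quaternion_algebra (D : falgType rat) : Prop :=
  quaternion_algebra D /\ ramified D InfinitePlace.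

(* D is (isomorphic to) D_{p,oo}. *)
Definition is_D_p_infty (p : nat) (D : falgType rat) : Prop :=
  [/\ quaternion_algebra D, ramified D InfinitePlace &
      forall q (q_pr : prime q), ramified D (FinitePlace q_pr) <-> q = p].

Section MatrixGroups.

Variables (D : falgType rat) (n : nat).

(* The inverses being in G, the elements of G are in GL_n(D). *)
Definition finite_subgroup (G : {fset 'M[D]_n}) : Prop :=
  [/\ 1%:M \in G,
      {in G &, forall g h, g *m h \in G} &
      {in G, forall g, exists2 h, h \in G & g *m h = 1%:M /\ h *m g = 1%:M}].

Definition maximal_finite_subgroup (G : {fset 'M[D]_n}) : Prop :=
  finite_subgroup G /\
  forall H : {fset 'M[D]_n}, finite_subgroup H -> {subset G <= H} -> H = G.

(* 'rV[D]_n is a left D-module, on which 'M[D]_n acts on the right by *m.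
   (c g)%:A *: g is the rational multiple c g of the matrix g. *)
Definition absolutely_irreducible (G : {fset 'M[D]_n}) : Prop :=
  forall X : 'M[D]_n,
    exists c : 'M[D]_n -> rat, X = \sum_(g <- G) (c g)%:A *: g.

Definition irreducible (G : {fset 'M[D]_n}) : Prop :=
  (0 < n)%N /\
  forall W : {pred 'rV[D]_n}, submod_closed W ->
    (forall g v, g \in G -> v \in W -> v *m g \in W) ->
    (forall v, v \in W -> v = 0) \/ (forall v, v \in W).

Definition direct_sum_decomposition s (V : 'I_s -> {pred 'rV[D]_n}) : Prop :=
  [/\ forall i, submod_closed (V i),
      forall v, exists2 w : 'I_s -> 'rV[D]_n,
        (forall i, w i \in V i) & v = \sum_i w i &
      forall w : 'I_s -> 'rV[D]_n,
        (forall i, w i \in V i) -> \sum_i w i = 0 -> forall i, w i = 0].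

(* As the elements of G are invertible, the condition says V_i g = V_(t i). *)
Definition permutes s (V : 'I_s -> {pred 'rV[D]_n}) (G : {fset 'M[D]_n}) :=
  {in G, forall g, exists t : {perm 'I_s},
    forall i v, (v *m g \in V (t i)) = (v \in V i)}.

Definition imprimitive (G : {fset 'M[D]_n}) : Prop :=
  irreducible G /\
  exists s (V : 'I_s -> {pred 'rV[D]_n}),
    [/\ (1 < s)%N, direct_sum_decomposition V,
        forall i, exists2 v, v \in V i & v != 0 & permutes V G].

Definition group_isomorphic (G : {fset 'M[D]_n}) (gT : finGroupType) : Prop :=
  exists f : gT -> 'M[D]_n,
    [/\ injective f, forall x y, f (x * y)%g = f x *m f y &
        forall g, g \in G <-> exists x, g = f x].

End MatrixGroups.

Section WreathProduct.

Variables (gT : finGroupType) (n : nat).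

Local Notation gTn := {dffun forall i : 'I_n, gT}.

Definition wreath_act (f : gTn) (s : 'S_n) : gTn := [ffun i => f (s^-1%g i)].

Lemma wreath_act1 : wreath_act^~ 1%g =1 id.
Proof. by move=> f; apply/ffunP => i; rewrite ffunE invg1 perm1. Qed.

Lemma wreath_actM f : act_morph wreath_act f.
Proof. by move=> s t; apply/ffunP => i; rewrite !ffunE invMg permM. Qed.

Definition wreath_action := TotalAction wreath_act1 wreath_actM.

Lemma wreath_is_groupAction : is_groupAction [set: gTn] wreath_action.
Proof.
move=> s _; apply/setIdP; split; first by apply/subsetP => f _; rewrite inE.
apply/morphicP => f g _ _; rewrite !actpermE.
by apply/ffunP => i; rewrite !ffunE.
Qed.

Definition wreath_groupAction := GroupAction wreath_is_groupAction.

(* gT^n ><| Sym_n *)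
Definition wreath_product : finGroupType := sdprod_by wreath_groupAction.

End WreathProduct.

Definition SL2_F3 : {set {'GL_2['F_3]}} :=
  [set g : {'GL_2['F_3]} | \det (GLval g) == 1].

Lemma SL2_F3_group_set : group_set SL2_F3.
Proof.
apply/group_setP; split=> [|g h]; rewrite !inE ?det1 //.
by move=> /eqP dg /eqP dh; rewrite GL_MxE det_mulmx dg dh mulr1.
Qed.

Canonical SL2_F3_group := Group SL2_F3_group_set.

(* The group defined by this presentation is finite (of order 12), so \isog Grp
   is a genuine isomorphism. *)
Definition is_Dic12 (gT : finGroupType) : Prop :=
  ([set: gT] \isog Grp (a : b :
    (a ^+ 6, b ^+ 2 = a ^+ 3, b * a * b^-1 = a^-1)))%g.

(* Main.v *)
(* A nontrivial system of imprimitivity of V = D^2 consists of two lines permuted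
   transitively by G, so in a suitable basis G consists of monomial matrices whose entries
   form a finite subgroup U of D^*. For every finite U' containing U the wreath product of
   U' with Sym_2 is again finite, hence equals G by maximality; moreover U spans D because
   G spans M_2(D).

   Elements of U have norm 1 and integral trace in [-2, 2]. If w in U has trace -1 and
   does not commute with y in U, Fricke's identity
     tr [w, y] = u^2 + u v + v^2 - 1,  u = tr y,  v = tr (w y),
   forces u^2 + u v + v^2 to be 0 or 1. In the second case, and also when no element of U
   has trace -1, U contains anticommuting i, j with i^2 = j^2 = -1; then D = (-1, -1) and
   integrality of the traces of u, u i, u j, u i j puts U inside the 24 Hurwitz units,
   which reduction modulo 3 identifies with SL_2(F_3). If the first case occurs for all
   such y, then y w = w^-1 y and y^2 = -1, so D = (-1, -3) and U lies in a dicyclic group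
   of order 12.

   The ramification of (-1, -1) and (-1, -3) is read off from the norm form: descent
   modulo 8 and 27 shows it anisotropic at 2 and at 3 respectively, and Hensel's lemma
   produces a zero at the other primes. *)

From HB Require Import structures.
Require Import Defs.
From mathcomp Require Import boolp.
From mathcomp Require Import all_boot all_order all_algebra.
From mathcomp Require Import all_fingroup all_field finmap.
From mathcomp Require Import ring lra zify.

Set Implicit Arguments.
Unset Strict Implicit.
Unset Printing Implicit Defensive.

Import Order.TTheory GRing.Theory Num.Theory.
Local Open Scope ring_scope.

(** * Quaternion relations and scalar extension *)

(** The reduced norm form of the algebra (a, b), over an arbitrary ring because it is used over the
    integers, the rationals and the completions. *)
Definition quat_norm (R : pzRingType) (a b x0 x1 x2 x3 : R) : R :=
  x0 ^+ 2 - a * x1 ^+ 2 - b * x2 ^+ 2 + a * b * x3 ^+ 2.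

Section QuaternionRelations.

Variables (F : fieldType) (A : algType F) (a b : F) (i j : A).

Definition quat (x0 x1 x2 x3 : F) : A :=
  x0 *: 1 + x1 *: i + x2 *: j + x3 *: (i * j).

Hypotheses (ii : i ^+ 2 = a%:A) (jj : j ^+ 2 = b%:A) (ji : j * i = - (i * j)).

Lemma quatD x0 x1 x2 x3 y0 y1 y2 y3 :
  quat x0 x1 x2 x3 + quat y0 y1 y2 y3 =
  quat (x0 + y0) (x1 + y1) (x2 + y2) (x3 + y3).
Proof.
rewrite /quat !scalerDl [LHS](AC (4*4) ((1*5)*(2*6)*(3*7)*(4*8))).
by [].
Qed.

Lemma quatZ c x0 x1 x2 x3 :
  c *: quat x0 x1 x2 x3 = quat (c * x0) (c * x1) (c * x2) (c * x3).
Proof. by rewrite /quat !scalerDr !scalerA. Qed.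

Lemma quat_scalar c : c *: 1 = quat c 0 0 0.
Proof. by rewrite /quat !scale0r !addr0. Qed.

Lemma quat_i : i = quat 0 1 0 0.
Proof. by rewrite /quat !scale0r scale1r !addr0 add0r. Qed.

Lemma quat_j : j = quat 0 0 1 0.
Proof. by rewrite /quat !scale0r scale1r !addr0 !add0r. Qed.

Lemma quat_k : i * j = quat 0 0 0 1.
Proof. by rewrite /quat !scale0r scale1r !add0r. Qed.

Lemma quatM x0 x1 x2 x3 y0 y1 y2 y3 :
  quat x0 x1 x2 x3 * quat y0 y1 y2 y3 =
  quat (x0 * y0 + a * (x1 * y1) + b * (x2 * y2) - a * b * (x3 * y3))
       (x0 * y1 + x1 * y0 - b * (x2 * y3) + b * (x3 * y2))
       (x0 * y2 + x2 * y0 + a * (x1 * y3) - a * (x3 * y1))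
       (x0 * y3 + x3 * y0 + x1 * y2 - x2 * y1).
Proof.
have ii' : i * i = a *: 1 by rewrite -expr2.
have jj' : j * j = b *: 1 by rewrite -expr2.
have iij : i * (i * j) = a *: j by rewrite mulrA ii' -scalerAl mul1r.
have iji : i * j * i = (- a) *: j by rewrite -mulrA ji mulrN iij scaleNr.
have ijj : i * j * j = b *: i by rewrite -mulrA jj' -scalerAr mulr1.
have jij : j * (i * j) = (- b) *: i by rewrite mulrA ji mulNr ijj scaleNr.
have ijij : i * j * (i * j) = (- (a * b)) *: 1.
  by rewrite -mulrA jij -scalerAr ii' scalerA mulNr mulrC.
have ji' : j * i = (-1) *: (i * j) by rewrite ji scaleN1r.
rewrite {1 2}/quat !mulrDl !mulrDr -!scalerAl -!scalerAr.
rewrite !(mul1r, mulr1) ii' jj' iij iji ijj jij ijij ji' !scalerA.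
rewrite -[x0 * y0 *: 1]addr0.
have q0 := quat_scalar.
have q1 c : c *: i = quat 0 c 0 0 by rewrite /quat !scale0r !addr0 add0r.
have q2 c : c *: j = quat 0 0 c 0 by rewrite /quat !scale0r !addr0 !add0r.
have q3 c : c *: (i * j) = quat 0 0 0 c by rewrite /quat !scale0r !add0r.
by rewrite !(q0, q1, q2, q3) addr0 !quatD; congr quat; ring.
Qed.

Lemma quat_conjr x0 x1 x2 x3 :
  quat x0 x1 x2 x3 * quat x0 (- x1) (- x2) (- x3) =
  (quat_norm a b x0 x1 x2 x3)%:A.
Proof.
by rewrite quatM quat_scalar; congr quat; rewrite /quat_norm; ring.
Qed.

Hypotheses (a0 : a != 0) (b0 : b != 0) (two0 : 2%:R != 0 :> F).

(** The map x |-> a^-1 i x i fixes 1 and i and negates j and ij, so averaging it with the identity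
    projects onto the span of 1 and i; likewise with j. Both projections together isolate [x0], and
    multiplying by i, j and ij brings the other coefficients into that place. *)
Lemma quat_eq0 x0 x1 x2 x3 : quat x0 x1 x2 x3 = 0 ->
  [/\ x0 = 0, x1 = 0, x2 = 0 & x3 = 0].
Proof.
have step y0 y1 y2 y3 : quat y0 y1 y2 y3 = 0 ->
    quat y0 y1 0 0 = 0 /\ quat y0 0 y2 0 = 0.
  move=> y0E.
  have : (2 * a)^-1 *: (i * quat y0 y1 y2 y3 * i) + 2%:R^-1 *: quat y0 y1 y2 y3 = 0.
    by rewrite y0E mulr0 mul0r !scaler0 addr0.
  have : (2 * b)^-1 *: (j * quat y0 y1 y2 y3 * j) + 2%:R^-1 *: quat y0 y1 y2 y3 = 0.
    by rewrite y0E mulr0 mul0r !scaler0 addr0.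
  rewrite {1 2}quat_i {1 2}quat_j !quatM !quatZ !quatD => <- H.
  by split; [rewrite -[RHS]H|]; congr quat; field; rewrite ?a0 ?b0 ?two0.
have one y : quat y 0 0 0 = 0 -> y = 0.
  rewrite /quat !scale0r !addr0 => /eqP; rewrite scaler_eq0 oner_eq0 orbF.
  by move/eqP.
have e0 y0 y1 y2 y3 : quat y0 y1 y2 y3 = 0 -> y0 = 0.
  by move=> /step[/step[_ /one]].
move=> E.
have /e0 := E; move=> x00.
have : i * quat x0 x1 x2 x3 = 0 by rewrite E mulr0.
rewrite {1}quat_i quatM => /e0 x10.
have : j * quat x0 x1 x2 x3 = 0 by rewrite E mulr0.
rewrite {1}quat_j quatM => /e0 x20.
have : i * j * quat x0 x1 x2 x3 = 0 by rewrite E mulr0.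
rewrite {1}quat_k quatM => /e0 x30.
have z (c y : F) : c != 0 -> c * y = 0 -> y = 0.
  by move=> c0 /eqP; rewrite mulf_eq0 (negbTE c0) => /eqP.
split=> //.
- by apply: (z _ _ a0); rewrite -[RHS]x10; ring.
- by apply: (z _ _ b0); rewrite -[RHS]x20; ring.
apply: (z (- (a * b))); first by rewrite oppr_eq0 mulf_neq0.
by rewrite -[RHS]x30; ring.
Qed.

End QuaternionRelations.

Section ScalarExtensionAlgebra.

Variables (F L : fieldType) (iota : {rmorphism F -> L}) (A : falgType F).

Local Notation E := (scalar_ext iota A).

Lemma scalar_ext_in_eq0 (u : A) : (@scalar_ext_in _ _ iota A u == 0) = (u == 0).
Proof.
apply/eqP/eqP => [/rowP u0|->]; last exact: scalar_ext_in0.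
rewrite (coord_vbasis (memvf u)) big1 // => k _.
have /eqP := u0 k; rewrite !mxE fmorph_eq0 => /eqP ->.
by rewrite scale0r.
Qed.

(** This fact and the next two make the scalar extension an algebra over [L], so that the calculus
    of [quat] applies to localizations. *)
Fact scalar_ext_oner_neq0 : (1 : E) != 0.
Proof. by rewrite scalar_ext_in_eq0 oner_eq0. Qed.

HB.instance Definition _ := GRing.PzSemiRing_isNonZero.Build E scalar_ext_oner_neq0.

Fact scalar_ext_scalerAl (c : L) (x y : E) : c *: (x * y) = (c *: x) * y.
Proof. by rewrite [RHS]scalar_ext_mulZl. Qed.

HB.instance Definition _ := GRing.Lmodule_isLalgebra.Build L E scalar_ext_scalerAl.

Fact scalar_ext_scalerAr (c : L) (x y : E) : c *: (x * y) = x * (c *: y).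
Proof. by rewrite [RHS]scalar_ext_mulZr. Qed.

HB.instance Definition _ := GRing.Lalgebra_isAlgebra.Build L E scalar_ext_scalerAr.

End ScalarExtensionAlgebra.

Section QuaternionScalarExtension.

Variables (L : fieldType) (iota : {rmorphism rat -> L}) (D : falgType rat).
Variables (a b : rat) (i j : D).
Hypotheses (ii : i ^+ 2 = a%:A) (jj : j ^+ 2 = b%:A) (ji : j * i = - (i * j)).
Hypotheses (a0 : a != 0) (b0 : b != 0).
Hypothesis span_ij : forall x, exists x0 x1 x2 x3, x = quat i j x0 x1 x2 x3.

Local Notation E := (scalar_ext iota D).
Local Notation e := (scalar_ext_in iota (A:=D)).

Let eii : (e i : E) ^+ 2 = (iota a)%:A.
Proof. by rewrite expr2 [LHS]scalar_ext_inM -expr2 ii scalar_ext_inZ. Qed.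

Let ejj : (e j : E) ^+ 2 = (iota b)%:A.
Proof. by rewrite expr2 [LHS]scalar_ext_inM -expr2 jj scalar_ext_inZ. Qed.

Let eji : (e j : E) * e i = - ((e i : E) * e j).
Proof.
rewrite [LHS]scalar_ext_inM ji.
have -> : (e i : E) * e j = e (i * j) by exact: scalar_ext_inM.
by rewrite -scaleN1r scalar_ext_inZ rmorphN1 scaleN1r.
Qed.

Local Notation equat := (@quat L E (e i) (e j)).

Lemma scalar_ext_in_quat x0 x1 x2 x3 :
  e (quat i j x0 x1 x2 x3) = equat (iota x0) (iota x1) (iota x2) (iota x3).
Proof.
rewrite /quat !scalar_ext_inD !scalar_ext_inZ.
by congr (_ + _ *: _); symmetry; exact: scalar_ext_inM.
Qed.

Lemma scalar_ext_span (x : E) : exists x0 x1 x2 x3, x = equat x0 x1 x2 x3.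
Proof.
rewrite (scalar_ext_expand x).
elim/big_rec: _ => [|k y _ [y0 [y1 [y2 [y3 ->]]]]].
  by exists 0, 0, 0, 0; rewrite /quat !scale0r !addr0.
have [z0 [z1 [z2 [z3 ->]]]] := span_ij (vbasis {:D})`_k.
by rewrite scalar_ext_in_quat quatZ quatD; do 4!eexists.
Qed.

(** Both directions rest on the product of x with its conjugate being its norm: a nontrivial zero of
    the form yields zero divisors, and otherwise the conjugate divided by the norm is the
    inverse. *)
Lemma division_scalar_extP :
  division_ring E <->
  forall x0 x1 x2 x3, quat_norm (iota a) (iota b) x0 x1 x2 x3 = 0 ->
    [/\ x0 = 0, x1 = 0, x2 = 0 & x3 = 0].
Proof.
have ia0 : iota a != 0 by rewrite fmorph_eq0.
have ib0 : iota b != 0 by rewrite fmorph_eq0.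
have i2 : 2%:R != 0 :> L by rewrite -(rmorph_nat iota) fmorph_eq0.
have free := quat_eq0 eii ejj eji ia0 ib0 i2.
split=> [[_ divE] x0 x1 x2 x3 n0|aniso].
  have [q0|/divE[y [yq _]]] := eqVneq (equat x0 x1 x2 x3) 0; first exact: free.
  have := quat_conjr eii ejj eji x0 x1 x2 x3; rewrite n0 scale0r.
  move/(congr1 ( *%R y)); rewrite mulrA yq mul1r mulr0 => /free[-> /eqP + /eqP + /eqP].
  by rewrite !oppr_eq0 => /eqP-> /eqP-> /eqP->.
split=> [|x]; first exact: oner_neq0.
have [x0 [x1 [x2 [x3 ->]]]] := scalar_ext_span x => q0.
set n := quat_norm (iota a) (iota b) x0 x1 x2 x3.
have n0 : n != 0.
  apply: contraNneq q0 => /aniso[-> -> -> ->].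
  by rewrite /quat !scale0r !addr0.
exists (n^-1 *: equat x0 (- x1) (- x2) (- x3)).
rewrite -scalerAl -scalerAr (quat_conjr eii ejj eji) -/n scalerA mulVf // scale1r.
split=> //.
have := quat_conjr eii ejj eji x0 (- x1) (- x2) (- x3); rewrite !opprK => ->.
by rewrite /quat_norm !sqrrN -/(quat_norm _ _ _ _ _ _) -/n scalerA mulVf // scale1r.
Qed.

End QuaternionScalarExtension.

(** * Reduced trace and norm *)

(** The interface through which the group theory sees D: Cayley-Hamilton, the absence of zero
    divisors through [rnm_eq0], and centre Q. No basis of D is mentioned. *)
Record reduced_trace_norm (D : algType rat) (tr nm : D -> rat) : Prop := {
  rtrn_sqr : forall x, x * x = tr x *: x - (nm x)%:A;
  rtrD : {morph tr : x y / x + y};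
  rtrZ : forall c x, tr (c *: x) = c * tr x;
  rtr1 : tr 1 = 2;
  rtrC : forall x y, tr (x * y) = tr (y * x);
  rnmM : {morph nm : x y / x * y};
  rnm_eq0 : forall x, nm x = 0 -> x = 0;
  rtrn_center : forall x : D, (forall y, x * y = y * x) -> exists c : rat, x = c%:A;
  rtrn_noncomm : ~ forall x y : D, x * y = y * x
}.

Section QuaternionBasis.

Variables (F : fieldType) (D : falgType F) (i j : D).
Local Notation B := [:: 1; i; j; i * j].

Lemma quat_span : basis_of {:D} B ->
  forall x, exists x0 x1 x2 x3, x = quat i j x0 x1 x2 x3.
Proof.
move=> bB x; have := coord_basis (X := in_tuple B) bB (memvf x).
by rewrite !big_ord_recr big_ord0 /= add0r => ->; do 4!eexists.
Qed.

Lemma quat_basis (a b : F) : 2%:R != 0 :> F -> \dim {:D} = 4%N ->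
  i ^+ 2 = a%:A -> j ^+ 2 = b%:A -> j * i = - (i * j) -> a != 0 -> b != 0 ->
  basis_of {:D} B.
Proof.
move=> two0 dimD ii jj ji a0 b0; rewrite basisEfree dimD leqnn subvf !andbT.
apply/(@freeP _ _ _ (in_tuple B)) => k.
rewrite !big_ord_recr big_ord0 /= add0r => /(quat_eq0 ii jj ji a0 b0 two0).
case=> k0 k1 k2 k3; case=> [[|[|[|[|//]]]] lt_m].
- by rewrite -[RHS]k0; congr k; apply: val_inj.
- by rewrite -[RHS]k1; congr k; apply: val_inj.
- by rewrite -[RHS]k2; congr k; apply: val_inj.
by rewrite -[RHS]k3; congr k; apply: val_inj.
Qed.

End QuaternionBasis.

Lemma exists_reduced_trace_norm (D : falgType rat) :
  definite_quaternion_algebra D -> exists tr nm : D -> rat, reduced_trace_norm tr nm.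
Proof.
case=> [[a [b [i [j [[a0 b0 ii jj ji] bB]]]]]] ramD.
have span_ij := quat_span bB.
have two0 : 2%:R != 0 :> rat by [].
have free := quat_eq0 ii jj ji a0 b0 two0.
(* A rational zero of the norm form is also a zero over the completion at infinity, where D is a
   division ring; [f] below is the embedding of the rationals there. *)
have aniso x0 x1 x2 x3 : quat_norm a b x0 x1 x2 x3 = 0 ->
    [/\ x0 = 0, x1 = 0, x2 = 0 & x3 = 0].
  move=> n0; have /division_scalar_extP := ramD.
  move=> /(_ _ _ _ _ ii jj ji a0 b0 span_ij).
  set f := (f in f a); move=> /(_ (f x0) (f x1) (f x2) (f x3)) H.
  case: H => [|/eqP + /eqP + /eqP + /eqP].
    rewrite /quat_norm -!rmorphXn -!rmorphM -!rmorphB -rmorphD.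
    by rewrite -/(quat_norm _ _ _ _ _ _) n0 rmorph0.
  by rewrite !fmorph_eq0 => /eqP-> /eqP-> /eqP-> /eqP->.
have /choice[c cE] : forall x, exists c : rat * rat * rat * rat,
    x = quat i j c.1.1.1 c.1.1.2 c.1.2 c.2.
  by move=> x; have [x0 [x1 [x2 [x3 ->]]]] := span_ij x; exists (x0, x1, x2, x3).
have cK x0 x1 x2 x3 : c (quat i j x0 x1 x2 x3) = (x0, x1, x2, x3).
  have := cE (quat i j x0 x1 x2 x3); case: (c _) => [[[y0 y1] y2] y3] /= E.
  have : quat i j x0 x1 x2 x3 + -1 *: quat i j y0 y1 y2 y3 = 0.
    by rewrite -E scaleN1r subrr.
  rewrite quatZ quatD => /free[]; rewrite !mulN1r.
  by do 4!move/subr0_eq->.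
exists (fun x => 2 * (c x).1.1.1).
exists (fun x => quat_norm a b (c x).1.1.1 (c x).1.1.2 (c x).1.2 (c x).2).
split.
- move=> x; have [x0 [x1 [x2 [x3 ->]]]] := span_ij x; rewrite cK /=.
  rewrite (quatM ii jj ji) (quat_scalar i j) -scaleN1r !quatZ quatD.
  by congr quat; rewrite /quat_norm; ring.
- move=> x y; have [x0 [x1 [x2 [x3 ->]]]] := span_ij x.
  have [y0 [y1 [y2 [y3 ->]]]] := span_ij y.
  by rewrite quatD !cK /=; ring.
- move=> k x; have [x0 [x1 [x2 [x3 ->]]]] := span_ij x.
  by rewrite quatZ !cK /=; ring.
- have -> : (1 : D) = quat i j 1 0 0 0 by rewrite -(quat_scalar i j) scale1r.
  by rewrite cK mulr1.
- move=> x y; have [x0 [x1 [x2 [x3 ->]]]] := span_ij x.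
  have [y0 [y1 [y2 [y3 ->]]]] := span_ij y.
  by rewrite !(quatM ii jj ji) !cK /=; ring.
- move=> x y; have [x0 [x1 [x2 [x3 ->]]]] := span_ij x.
  have [y0 [y1 [y2 [y3 ->]]]] := span_ij y.
  by rewrite !(quatM ii jj ji) !cK /quat_norm /=; ring.
- move=> x; have [x0 [x1 [x2 [x3 ->]]]] := span_ij x; rewrite cK /= => /aniso.
  by case=> -> -> -> ->; rewrite /quat !scale0r !addr0.
- move=> x cx; have [x0 [x1 [x2 [x3 xE]]]] := span_ij x; exists x0.
  have := cx (quat i j 0 1 0 0); have := cx (quat i j 0 0 1 0); rewrite {}xE.
  rewrite !(quatM ii jj ji) => E1 E2.
  have := congr1 c E1; rewrite !cK => -[_ e1 _ e3].
  have := congr1 c E2; rewrite !cK => -[_ _ _ e2].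
  have x30 : x3 = 0.
    move/eqP: e1; rewrite -subr_eq0 (_ : _ - _ = 2%:R * b * x3); last by ring.
    by rewrite !mulf_eq0 (negbTE b0) /= => /eqP.
  have -> : x1 = 0 by move: e3; clear; lra.
  have -> : x2 = 0 by move: e2; clear; lra.
  by rewrite x30 (quat_scalar i j).
move=> /(_ i j) E; have := congr1 c E.
by rewrite ji (quat_k i j) -scaleN1r quatZ !cK => -[]; clear; lra.
Qed.

(** * Elements of finite order *)

Section PeriodicRecurrence.

Variables (t : rat) (f : nat -> rat) (m : nat).
Hypotheses (m_gt0 : (0 < m)%N) (f0 : f 0%N != 0).
Hypothesis f_per : forall k, f (k + m)%N = f k.
Hypothesis f_rec : forall k, t * f k.+1 = f k.+2 + f k.

Let f_mod k : f k = f (k %% m).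
Proof.
rewrite {1}(divn_eq k m) addnC; elim: (k %/ m)%N => [|q IH]; first by rewrite mul0n addn0.
by rewrite mulSnr addnA f_per.
Qed.

(** At an index where |f| is maximal, t times this value is a sum of two values of f, hence at most
    twice the maximum in absolute value. *)
Lemma periodic_rec_le2 : `|t| <= 2.
Proof.
pose i := [arg max_(i > Ordinal m_gt0) `|f (val i)|]%O.
have fi k : `|f k| <= `|f i|.
  rewrite f_mod /i; case: (@Order.TotalTheory.arg_maxP _ _ 'I_m) => // {}i _.
  by move=> /(_ (Ordinal (ltn_pmod k m_gt0)) isT).
have fi0 : 0 < `|f i| by apply: lt_le_trans (fi 0%N); rewrite normr_gt0.
(* The maximum is moved to [i + m], which is positive and so has a predecessor. *)
move: fi fi0; rewrite -(f_per i) => fi fi0.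
rewrite -(ler_pM2r fi0) -normrM -{1}(prednK (n := (i + m)%N)); last first.
  by rewrite addn_gt0 m_gt0 orbT.
rewrite f_rec; apply: le_trans (ler_normD _ _) _.
by have := fi (i + m).-1.+2; have := fi (i + m).-1; lra.
Qed.

(* The values share a denominator; if s is the denominator of t, then s divides all
   the numerators, hence so does every power of s. *)
Lemma periodic_rec_int : t \is a Num.int.
Proof.
pose d := \prod_(i < m) denq (f i).
have d0 : d != 0 by apply/prodf_neq0 => i _; exact: denq_neq0.
have /choice[n nE] : forall k, exists z : int, z%:~R = d%:~R * f k.
  move=> k; pose l := Ordinal (ltn_pmod k m_gt0).
  exists (numq (f l) * \prod_(i < m | i != l) denq (f i)).
  by rewrite [d](bigD1 l) //= !intrM [f k]f_mod mulrAC [_ * f _]mulrC -numqE.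
have s_dvd K k : (K <= k)%N -> ((denq t ^+ K)%R %| n k)%Z.
  elim: K k => [|K IH] [|k] //; rewrite ?expr0 ?dvd1z // => Kk.
  have E : numq t * n k.+1 = denq t * (n k.+2 + n k).
    apply: (@intr_inj rat); rewrite !intrM intrD !nE -mulrDr -f_rec numqE; ring.
  have := dvdz_mul (dvdzz (denq t)) (rpredD (IH k.+2 (leqW (leqW Kk))) (IH k Kk)).
  rewrite -exprS -E Gauss_dvdzr // coprimezE abszX coprimeXl // coprime_sym.
  exact: coprime_num_den.
have n_per K : n (K * m)%N = n 0%N.
  elim: K => // K IH; apply: (@intr_inj rat); rewrite nE mulSnr f_per -nE IH //.
have n0 : n 0%N != 0 by rewrite -(intr_eq0 rat) nE mulf_neq0 ?intr_eq0.
have [s1|s1] := leqP `|denq t|%N 1; last first.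
  have := s_dvd `|n 0%N|%N (`|n 0%N| * m)%N (leq_pmulr _ m_gt0).
  rewrite n_per dvdzE abszX => /dvdn_leq; rewrite absz_gt0 n0 => /(_ isT).
  by rewrite leqNgt ltn_expl.
rewrite Qint_def; have := denq_gt0 t; lia.
Qed.

End PeriodicRecurrence.

Section FiniteOrder.

Variables (D : algType rat) (tr nm : D -> rat).
Hypothesis H : reduced_trace_norm tr nm.

Lemma rtr0 : tr 0 = 0.
Proof. by rewrite -(scale0r (0 : D)) (rtrZ H) mul0r. Qed.

Lemma rtrN x : tr (- x) = - tr x.
Proof. by rewrite -scaleN1r (rtrZ H) mulN1r. Qed.

Lemma rtrB x y : tr (x - y) = tr x - tr y.
Proof. by rewrite (rtrD H) rtrN. Qed.

Lemma rnm1 : nm 1 = 1.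
Proof.
have n1 : nm 1 != 0 by apply/eqP => /(rnm_eq0 H)/eqP; rewrite oner_eq0.
by apply: (mulfI n1); rewrite -(rnmM H) !mulr1.
Qed.

Lemma rnmX x n : nm (x ^+ n) = nm x ^+ n.
Proof. by elim: n => [|n IH]; rewrite ?rnm1 // !exprS (rnmM H) IH. Qed.

Lemma rnm_scalar (c : rat) : nm (c *: 1) = c ^+ 2.
Proof.
have := rtrn_sqr H (c *: 1); rewrite (rtrZ H) (rtr1 H) -scalerAl mul1r !scalerA -scalerBl.
move/eqP; rewrite -subr_eq0 -scalerBl scaler_eq0 oner_eq0 orbF => /eqP.
by lra.
Qed.

Lemma quat_mul_eq0 (x y : D) : x * y = 0 -> x = 0 \/ y = 0.
Proof.
move=> xy0; have : nm x * nm y = 0.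
  by rewrite -(rnmM H) xy0 -(scale0r (1 : D)) rnm_scalar expr0n.
by move/eqP; rewrite mulf_eq0 => /orP[]/eqP/(rnm_eq0 H); [left|right].
Qed.

Definition finite_order (x : D) := exists2 m, (0 < m)%N & x ^+ m = 1.

(** The sequence tr (x^k) is periodic, and Cayley-Hamilton with norm 1 is the recurrence with t = tr
    x. *)
Lemma finite_order_trace1 x : finite_order x -> nm x = 1 ->
  tr x \is a Num.int /\ `|tr x| <= 2.
Proof.
case=> m m0 xm nx.
have per k : tr (x ^+ (k + m)) = tr (x ^+ k) by rewrite exprD xm mulr1.
have rec k : tr x * tr (x ^+ k.+1) = tr (x ^+ k.+2) + tr (x ^+ k).
  rewrite -(rtrZ H) -(rtrD H) !exprSr -mulrA (rtrn_sqr H) nx.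
  by rewrite mulrBr -scalerAr scale1r mulr1 subrK.
have t0 : tr (x ^+ 0) != 0 by rewrite expr0 (rtr1 H).
by split; [exact: periodic_rec_int m0 t0 per rec | exact: periodic_rec_le2 m0 t0 per rec].
Qed.

(** The norm is 1 or -1. If it were -1, then x^2 would have norm 1 and trace (tr x)^2 + 2 <= 2, so
    tr x = 0 and x^2 = 1; but then x is 1 or -1, of norm 1. *)
Lemma finite_order_nm x : finite_order x -> nm x = 1.
Proof.
case=> m m0 xm.
have : `|nm x| ^+ m == 1 by rewrite -normrX -rnmX xm rnm1 normr1.
rewrite pexpr_eq1 // => /eqP /eqP; rewrite eqr_norml ler01 andbT => /orP[/eqP//|/eqP nxN].
have x2 : x * x = tr x *: x + 1 by rewrite (rtrn_sqr H) nxN scaleN1r opprK.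
have fo2 : finite_order (x * x).
  by exists m; rewrite // -expr2 -exprM mulnC exprM xm expr1n.
have n2 : nm (x * x) = 1 by rewrite (rnmM H) nxN mulN1r opprK.
have [_] := finite_order_trace1 fo2 n2.
rewrite {1}x2 (rtrD H) (rtrZ H) (rtr1 H) -expr2 => t2.
have /eqP : tr x ^+ 2 = 0.
  by have := sqr_ge0 (tr x); move: t2; rewrite ler_norml => /andP[_]; lra.
rewrite expf_eq0 /= => /eqP tx0.
have /quat_mul_eq0 : (x - 1) * (x + 1) = 0.
  by rewrite mulrBl !mulrDr mul1r !mulr1 x2 tx0 scale0r add0r [x + 1]addrC subrr.
case=> [/subr0_eq xE|/eqP]; first by move: nxN; rewrite xE rnm1.
rewrite addr_eq0 => /eqP xE; move: nxN; rewrite xE -scaleN1r rnm_scalar sqrrN expr1n.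
by [].
Qed.

Lemma trace2_eq1 x : nm x = 1 -> tr x = 2 -> x = 1.
Proof.
move=> nx tx; have := rtrn_sqr H x; rewrite nx tx scale1r => E.
have /quat_mul_eq0 : (x - 1) * (x - 1) = 0.
  rewrite mulrBr mulrBl E mul1r mulr1 scaler_nat mulr2n.
  by rewrite [_ - 1 - x]addrAC addrK subrr.
by case=> /subr0_eq.
Qed.

Lemma traceN2_eqN1 x : nm x = 1 -> tr x = -2 -> x = -1.
Proof.
move=> nx tx; rewrite -[x]opprK (_ : - x = 1) //; apply: trace2_eq1.
  by rewrite -scaleN1r -mulr_algl (rnmM H) nx mulr1 rnm_scalar sqrrN expr1n.
by rewrite rtrN tx opprK.
Qed.

End FiniteOrder.

(** * Finite subgroups of the unit group *)

(* The last condition holds when U spans D over the rationals. *)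
Record unit_group (D : algType rat) (U : D -> Prop) : Prop := {
  ug1 : U 1;
  ugM : forall x y, U x -> U y -> U (x * y);
  ugV : forall x, U x -> exists2 y, U y & x * y = 1;
  ug_fin : forall x, U x -> finite_order x;
  ug_center : forall x, (forall u, U u -> x * u = u * x) -> forall y, x * y = y * x
}.

(** Multiply x y x y = -1 by x on the left and by y on the right. *)
Lemma anticomm_of_sqrN1 (R : pzRingType) (x y : R) :
  x * x = -1 -> y * y = -1 -> x * y * (x * y) = -1 -> y * x = - (x * y).
Proof.
move=> xx yy xyxy; have <- : x * (x * y * (x * y)) * y = - (x * y).
  by rewrite xyxy mulrN1 mulNr.
by rewrite !mulrA xx mulN1r -!mulrA yy mulrN1 mulrN mulNr opprK.
Qed.

Section UnitGroups.

Variables (D : algType rat) (tr nm : D -> rat).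
Hypothesis H : reduced_trace_norm tr nm.

Lemma nm1_sqr x : nm x = 1 -> x * x = tr x *: x - 1.
Proof. by move=> nx; rewrite (rtrn_sqr H) nx scale1r. Qed.

Lemma tr0_sqr x : nm x = 1 -> tr x = 0 -> x * x = -1.
Proof. by move=> /nm1_sqr -> ->; rewrite scale0r add0r. Qed.

Section OrderThree.

Variable w : D.
Hypotheses (nw : nm w = 1) (tw : tr w = -1).

Lemma order3_sqr : w * w = - w - 1.
Proof. by rewrite nm1_sqr // tw scaleN1r. Qed.

Lemma order3_cube : w * (w * w) = 1.
Proof. by rewrite order3_sqr mulrBr mulrN order3_sqr mulr1 opprB opprK addrK. Qed.

Lemma order3_cube' : w * w * w = 1.
Proof. by rewrite -mulrA order3_cube. Qed.

Lemma order3_mulNl y : w * w * y = - (w * y) - y.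
Proof. by rewrite order3_sqr mulrBl mulNr mul1r. Qed.

Lemma order3_tr2 y : tr (w * w * y) = - tr y - tr (w * y).
Proof. by rewrite order3_mulNl (rtrB H) (rtrN H) addrC. Qed.

Lemma order3_mul_tr y : nm y = 1 -> tr y = 0 -> tr (w * y * y) = 1.
Proof. by move=> ny ty; rewrite -mulrA tr0_sqr // mulrN1 (rtrN H) tw opprK. Qed.

(* Fricke's identity for the commutator of w and y. *)
Lemma order3_comm_tr y : nm y = 1 ->
  tr (w * y * (w * w) * ((tr y)%:A - y)) =
  tr y ^+ 2 + tr y * tr (w * y) + tr (w * y) ^+ 2 - 1.
Proof.
move=> ny; rewrite mulrBr (rtrB H) -scalerAr mulr1 (rtrZ H).
have -> : tr (w * y * (w * w)) = tr y by rewrite (rtrC H) mulrA order3_cube' mul1r.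
have -> : w * y * (w * w) * y = - (w * y * (w * y)) - (w * (y * y)).
  by rewrite order3_sqr mulrBr mulrBl mulr1 mulrN mulNr !mulrA.
rewrite (rtrB H) (rtrN H) (rtrn_sqr H (w * y)) (rnmM H) nw ny mulr1 scale1r.
rewrite (nm1_sqr ny) mulrBr -scalerAr mulr1 !(rtrB H) !(rtrZ H) (rtr1 H) tw.
by ring.
Qed.

Lemma order3_comm_eq1 y : nm y = 1 ->
  w * y * (w * w) * ((tr y)%:A - y) = 1 -> w * y = y * w.
Proof.
move=> ny /(congr1 (fun x => x * y * w)); rewrite mul1r.
rewrite -(mulrA _ _ y) mulrBl -scalerAl mul1r (nm1_sqr ny) opprB addrC subrK mulr1.
by rewrite -[_ * _ * w]mulrA order3_cube' mulr1.
Qed.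

(** The anticommuting pair is y and its conjugate w y w^-1. Their product has trace 1 - v^2 with v =
    tr (w y), so it also squares to -1. *)
Lemma order3_anticomm y : nm y = 1 -> tr y = 0 -> tr (w * y) ^+ 2 = 1 ->
  [/\ y * y = -1, w * y * (w * w) * (w * y * (w * w)) = -1 &
      w * y * (w * w) * y = - (y * (w * y * (w * w)))].
Proof.
move=> ny ty v1; have yy := tr0_sqr ny ty.
have jj : w * y * (w * w) * (w * y * (w * w)) = -1.
  rewrite -!mulrA (mulrA w w (w * _)) (mulrA (w * w) w) order3_cube' mul1r.
  by rewrite (mulrA y y) yy mulN1r mulrN order3_cube.
split=> //; apply: anticomm_of_sqrN1 => //.
apply: tr0_sqr; first by rewrite !(rnmM H) nw ny !mulr1.
rewrite (rtrC H) order3_sqr mulrBr mulr1 mulrN mulrBl mulNr.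
rewrite (rtrB H) (rtrN H) -[w * y * w * y]mulrA (rtrn_sqr H (w * y)).
rewrite (rtrB H) !(rtrZ H) (rtr1 H) -expr2 v1 (rnmM H) nw ny.
by rewrite order3_mul_tr //; lra.
Qed.

(** Both y and w y square to -1, hence w y w = - y^-1 = y. *)
Lemma order3_inverts y : nm y = 1 -> tr y = 0 -> tr (w * y) = 0 ->
  y * w = w * w * y.
Proof.
move=> ny ty v0; have yy := tr0_sqr ny ty.
have : w * y * (w * y) = -1 by apply: tr0_sqr; rewrite // (rnmM H) nw ny mulr1.
move/(congr1 (fun x => w * w * x * - y)).
rewrite mulrN1 mulrNN !mulrA order3_cube' mul1r -[_ * _ * - y]mulrA mulrN yy opprK mulr1.
by [].
Qed.

(** The centralizer of w is Q(w). Let t be the right-hand side: its coefficients are chosen so that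
    x = z - t and w x have trace 0. As x commutes with w, both x^2 and (w x)^2 = w^2 x^2 equal - nm
    x, so nm x = 0 because w^2 is not 1. *)
Lemma order3_centralizer z : w * z = z * w ->
  z = ((tr z - tr (w * z)) / 3)%:A - ((tr z + 2 * tr (w * z)) / 3) *: w.
Proof.
move=> cz; apply/eqP; rewrite -subr_eq0; set t := (X in z - X).
have ct : w * (z - t) = (z - t) * w.
  rewrite mulrBr mulrBl cz /t; move: (_ / 3) (_ / 3) => p q.
  by rewrite mulrBr mulrBl -!scalerAr -!scalerAl mulr1 mul1r.
have t0 : tr (z - t) = 0.
  by rewrite /t !(rtrB H) !(rtrZ H) (rtr1 H) tw; field.
have wt0 : tr (w * (z - t)) = 0.
  rewrite /t !mulrBr -!scalerAr mulr1 order3_sqr !(rtrB H) !(rtrZ H).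
  by rewrite (rtrB H) (rtrN H) (rtr1 H) tw; field.
move: (z - t) ct t0 wt0 => x cx tx0 wtx0.
have : w * x * (w * x) = w * w * (x * x).
  by rewrite -[LHS]mulrA [x * _]mulrA -cx !mulrA.
rewrite !(rtrn_sqr H (_ * _)) !(rtrn_sqr H x) tx0 wtx0 !scale0r !add0r.
rewrite (rnmM H) nw mul1r mulrN -scalerAr mulr1 order3_sqr => /oppr_inj /eqP.
rewrite -subr_eq0 -scalerBr scaler_eq0 => /orP[/eqP/(rnm_eq0 H)->//|/eqP e0].
have : tr (1 - (- w - 1)) = 0 by rewrite e0 (rtr0 H).
by rewrite !(rtrB H) (rtrN H) (rtr1 H) tw; lra.
Qed.

Lemma order6_exp2 : (1 + w) ^+ 2 = w.
Proof.
rewrite expr2 mulrDl !mulrDr !mul1r !mulr1 order3_sqr (addrA w) subrr add0r.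
by rewrite addrAC subrr add0r.
Qed.

Lemma order6_exp3 : (1 + w) ^+ 3 = -1.
Proof. by rewrite exprS order6_exp2 mulrDl mul1r order3_sqr addrA addrN add0r. Qed.

Lemma order6_exp4 : (1 + w) ^+ 4 = -1 - w.
Proof. by rewrite exprSr order6_exp3 mulN1r opprD. Qed.

Lemma order6_exp5 : (1 + w) ^+ 5 = - w.
Proof. by rewrite -[5%N]/(3 + 2)%N exprD order6_exp3 order6_exp2 mulN1r. Qed.

Lemma order6_exp6 : (1 + w) ^+ 6 = 1.
Proof. by rewrite -[6%N]/(3 * 2)%N exprM order6_exp3 sqrrN expr1n. Qed.

End OrderThree.

End UnitGroups.

(** For u = tr y and v = tr (w y) the trace of w^2 y is - u - v. Every case but the first says that
    one of y, w y, w^2 y has trace 0 and the cyclically next one has trace 1 or -1. *)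
Lemma trace_form_le2 (u v : rat) :
  u \in [:: -2; -1; 0; 1; 2] -> v \in [:: -2; -1; 0; 1; 2] ->
  u ^+ 2 + u * v + v ^+ 2 <= 2 ->
  [\/ u = 0 /\ v = 0, u = 0 /\ v ^+ 2 = 1, v = 0 /\ u ^+ 2 = 1 |
      u + v = 0 /\ u ^+ 2 = 1].
Proof.
move=> uT vT le2.
have /allP/(_ u uT)/allP/(_ v vT)/implyP/(_ le2) : all (fun u : rat => all (fun v : rat =>
    (u ^+ 2 + u * v + v ^+ 2 <= 2) ==>
      [|| (u == 0) && (v == 0), (u == 0) && (v ^+ 2 == 1),
          (v == 0) && (u ^+ 2 == 1) | (u + v == 0) && (u ^+ 2 == 1)])
    [:: -2; -1; 0; 1; 2]) [:: -2; -1; 0; 1; 2] by vm_compute.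
by case/or4P => /andP[/eqP ? /eqP ?]; [apply: Or41|apply: Or42|apply: Or43|apply: Or44].
Qed.

(** The six solutions are the pairs (tr z, tr (w z)) for the six units z of Z[w]. *)
Lemma trace_form_eq3 (r s : rat) :
  r \in [:: -2; -1; 0; 1; 2] -> s \in [:: -2; -1; 0; 1; 2] ->
  r ^+ 2 + r * s + s ^+ 2 = 3 ->
  (r, s) \in [:: (1, 1); (-1, -1); (2, -1); (-2, 1); (1, -2); (-1, 2)].
Proof.
move=> rT sT /eqP eq3.
have /allP/(_ r rT)/allP/(_ s sT)/implyP/(_ eq3) // : all (fun r : rat => all (fun s : rat =>
    (r ^+ 2 + r * s + s ^+ 2 == 3) ==>
      ((r, s) \in [:: (1, 1); (-1, -1); (2, -1); (-2, 1); (1, -2); (-1, 2)]))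
    [:: -2; -1; 0; 1; 2]) [:: -2; -1; 0; 1; 2] by vm_compute.
Qed.

Lemma trace_form_of_sqr (r s : rat) :
  (r ^+ 2 - 2 * r * s - 2 * s ^+ 2) / 3 = r * r - 2 -> r ^+ 2 + r * s + s ^+ 2 = 3.
Proof. by lra. Qed.

(** * The two types of unit groups *)

Section Dichotomy.

Variables (D : algType rat) (tr nm : D -> rat) (U : D -> Prop).
Hypotheses (H : reduced_trace_norm tr nm) (gU : unit_group U).

Lemma ug_nm x : U x -> nm x = 1.
Proof. by move=> /(ug_fin gU) /(finite_order_nm H). Qed.

Lemma ug_trace x : U x -> tr x \in [:: -2; -1; 0; 1; 2].
Proof.
move=> Ux; have [/intrP[z ->]] := finite_order_trace1 H (ug_fin gU Ux) (ug_nm Ux).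
rewrite ler_norml => /andP[z1 z2].
have : z \in [:: -2; -1; 0; 1; 2].
  have : -2 <= z <= 2 by rewrite -!(ler_int rat) z1 z2.
  by rewrite !inE; lia.
by rewrite !inE => /or4P[||| /orP[]] /eqP->.
Qed.

Lemma ug_conj x : U x -> U ((tr x)%:A - x).
Proof.
move=> Ux; have [y Uy xy] := ugV gU Ux; suff -> : (tr x)%:A - x = y by [].
rewrite -[LHS]mulr1 -[X in _ * X]xy mulrA mulrBl -scalerAl mul1r (nm1_sqr H (ug_nm Ux)).
by rewrite opprB addrC subrK mul1r.
Qed.

(** If U were commutative, [ug_center] would make each element of U central in D, and applied once
    more it would make D commutative. *)
Lemma ug_noncomm : exists x y, [/\ U x, U y & x * y <> y * x].
Proof.
apply: contrapT => no; apply: (rtrn_noncomm H) => x; apply: (ug_center gU) => u Uu.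
symmetry; move: x; apply: (ug_center gU) => v Uv.
by apply: contrapT => uv; apply: no; exists u, v.
Qed.

Lemma ug_noncomm_order3 w : U w -> tr w = -1 -> exists2 y, U y & w * y <> y * w.
Proof.
move=> Uw tw; apply: contrapT => no.
have [c wE] : exists c : rat, w = c%:A.
  apply: (rtrn_center H); apply: (ug_center gU) => u Uu.
  by apply: contrapT => wu; apply: no; exists u.
move: tw (ug_nm Uw); rewrite wE (rtrZ H) (rtr1 H) (rnm_scalar H) expr2 => tc.
have -> : c = - (1 / 2) by lra.
by lra.
Qed.

Definition quaternion_pair i j :=
  [/\ U i, U j, i * i = -1, j * j = -1 & j * i = - (i * j)].

Lemma order3_dichotomy w y : U w -> U y -> tr w = -1 -> w * y <> y * w ->
  (exists i j, quaternion_pair i j) \/ (tr y = 0 /\ tr (w * y) = 0).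
Proof.
move=> Uw Uy tw wy; have nw := ug_nm Uw; have ny := ug_nm Uy.
have Uwy := ugM gU Uw Uy; have Uww := ugM gU Uw Uw.
(* This is the commutator of w and y, since [w * w] is w^-1 and [(tr y)%:A - y] is y^-1. It differs
   from 1, so its trace is not 2 and is at most 1. *)
pose c := w * y * (w * w) * ((tr y)%:A - y).
have Uc : U c by rewrite /c; do 2?apply: (ugM gU) => //; exact: ug_conj.
have tc2 : tr c <> 2.
  move=> tc2; apply: wy; apply: (order3_comm_eq1 H nw tw ny).
  exact: (trace2_eq1 H (ug_nm Uc) tc2).
have tcE : tr c = _ := order3_comm_tr H nw tw ny.
have anti z : U z -> tr z = 0 -> tr (w * z) ^+ 2 = 1 -> exists i j, quaternion_pair i j.
  move=> Uz tz wz; have [zz jj ji] := order3_anticomm H nw tw (ug_nm Uz) tz wz.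
  by exists z, (w * z * (w * w)); split=> //; do 2?apply: (ugM gU).
have tr2 : tr (w * w * y) = - tr y - tr (w * y) by exact: (order3_tr2 H nw tw).
have tr3 : tr (w * (w * w * y)) = tr y by rewrite !mulrA (order3_cube' H nw tw) mul1r.
have tc : tr y ^+ 2 + tr y * tr (w * y) + tr (w * y) ^+ 2 - 1 <= 1.
  rewrite -tcE; have := ug_trace Uc; rewrite !inE.
  case/or4P => [||| /orP[]] /eqP tcE'; rewrite tcE'; [lra|lra|lra|lra|].
  by case: tc2.
have {}tc : tr y ^+ 2 + tr y * tr (w * y) + tr (w * y) ^+ 2 <= 2.
  by rewrite -lerBlDr in tc *; move: tc; rewrite !lerBlDr.
case: (trace_form_le2 (ug_trace Uy) (ug_trace Uwy) tc) => [[ty twy]|[ty tv]|[v0 tu]|[tuv tu]].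
- by right.
- by left; apply: (anti y).
- by left; apply: (anti (w * y)); rewrite // mulrA tr2 v0 subr0 sqrrN.
left; apply: (anti (w * w * y)); first exact: (ugM gU).
  by rewrite tr2 -opprD tuv oppr0.
by rewrite tr3.
Qed.

(* 1 + w = - w^-1 has order 6. *)
Lemma order3_centralizer_expr w z : U w -> tr w = -1 -> U z -> w * z = z * w ->
  exists k, z = (1 + w) ^+ k.
Proof.
move=> Uw tw Uz cz; have nw := ug_nm Uw.
have zE := order3_centralizer H nw tw cz.
have := nm1_sqr H (ug_nm Uz) => /(congr1 tr).
rewrite (rtrB H) (rtrZ H) (rtr1 H).
have -> : tr (z * z) = (tr z ^+ 2 - 2 * tr z * tr (w * z) - 2 * tr (w * z) ^+ 2) / 3.
  move: (tr z) (tr (w * z)) zE => r s ->.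
  rewrite mulrBr !mulrBl -!scalerAl -!scalerAr !mul1r mulr1 (order3_sqr H nw tw).
  rewrite !(rtrB H) !(rtrZ H) !(rtrB H) (rtrN H) (rtr1 H) tw.
  by field.
move=> sqE; have eq3 : tr z ^+ 2 + tr z * tr (w * z) + tr (w * z) ^+ 2 = 3.
  exact: trace_form_of_sqr.
have z_of p q : (tr z - tr (w * z)) / 3 = p -> (tr z + 2 * tr (w * z)) / 3 = q ->
  z = p%:A - q *: w by move=> <- <-.
have := trace_form_eq3 (ug_trace Uz) (ug_trace (ugM gU Uw Uz)) eq3; rewrite !inE.
case/or4P => [||| /or3P[]] /eqP[r1 s1]; rewrite r1 s1 in z_of.
- by exists 5%N; rewrite (order6_exp5 H nw tw) (z_of 0 1) // scale0r sub0r scale1r.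
- by exists 2%N; rewrite (order6_exp2 H nw tw) (z_of 0 (-1)) // scale0r sub0r scaleN1r opprK.
- by exists 0%N; rewrite expr0 (z_of 1 0) // scale0r subr0 scale1r.
- by exists 3%N; rewrite (order6_exp3 H nw tw) (z_of (-1) 0) // scale0r subr0 scaleN1r.
- by exists 1%N; rewrite expr1 (z_of 1 (-1)) // scale1r scaleN1r opprK.
by exists 4%N; rewrite (order6_exp4 H nw tw) (z_of (-1) 1) // scale1r scaleN1r.
Qed.

Theorem unit_group_dichotomy :
  (exists i j, quaternion_pair i j) \/
  exists w y, [/\ U w, U y, w * w = - w - 1, y * y = -1 & y * w = w * w * y] /\
    (forall u, U u -> exists k e, u = (1 + w) ^+ k * y ^+ e).
Proof.
have [ex_pair|no_pair] := pselect (exists i j, quaternion_pair i j); first by left.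
right.
have [[w [Uw tw]]|no_w] := pselect (exists w, U w /\ tr w = -1).
  have nw := ug_nm Uw; have [y Uy wy] := ug_noncomm_order3 Uw tw.
  have zero x : U x -> w * x <> x * w -> tr x = 0 /\ tr (w * x) = 0.
    by move=> Ux wx; case: (order3_dichotomy Uw Ux tw wx).
  have [ty twy] := zero y Uy wy; have ny := ug_nm Uy.
  have yy := tr0_sqr H ny ty; have yw := order3_inverts H nw tw ny ty twy.
  exists w, y; split; first by split=> //; exact: (order3_sqr H nw tw).
  have cent z : U z -> w * z = z * w -> exists k, z = (1 + w) ^+ k.
    exact: order3_centralizer_expr.
  move=> u Uu; have [/cent[//|k ->]|wu] := pselect (w * u = u * w).
    by exists k, 0%N; rewrite expr0 mulr1.
  have [tu twu] := zero u Uu wu.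
  have uw := order3_inverts H nw tw (ug_nm Uu) tu twu.
  (* Both u and y invert w under conjugation, so u y^-1 = - u y centralizes w and is a power of 1 +
     w. *)
  have UyN : U (- y) by have := ug_conj Uy; rewrite ty scale0r sub0r.
  have [||k uE] := cent (u * - y); first exact: (ugM gU).
    have uww : u * (w * w) = w * u.
      by rewrite mulrA uw -(mulrA (w * w)) uw !mulrA (order3_cube' H nw tw) mul1r.
    by rewrite !mulrN mulNr -(mulrA u y w) yw (mulrA u) uww mulrA.
  by exists k, 1%N; rewrite expr1 -uE -mulrA mulNr yy opprK mulr1.
(* Trace -1 is excluded, and so is trace 1, because x^2 would then have trace -1. Traces 2 and -2
   belong to 1 and -1, which are central. *)
have tr0 x y : U x -> U y -> x * y <> y * x -> tr x = 0.
  move=> Ux Uy xy; have nx := ug_nm Ux.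
  have := ug_trace Ux; rewrite !inE => /or4P[||| /orP[]] /eqP tx //.
  - by case: xy; rewrite (traceN2_eqN1 H nx tx) mulN1r mulrN1.
  - by case: no_w; exists x.
  - case: no_w; exists (x * x); split; first exact: (ugM gU).
    by rewrite (rtrn_sqr H) nx !(rtrB H, rtrZ H) (rtr1 H) tx.
  by case: xy; rewrite (trace2_eq1 H nx tx) mul1r mulr1.
have [i [j [Ui Uj ij]]] := ug_noncomm.
have ii := tr0_sqr H (ug_nm Ui) (tr0 i j Ui Uj ij).
have jj := tr0_sqr H (ug_nm Uj) (tr0 j i Uj Ui (fun e => ij (esym e))).
have Uij := ugM gU Ui Uj.
have tij : tr (i * j) = 0.
  apply: (tr0 _ i Uij Ui) => /(congr1 ( *%R (- i))).
  by rewrite !mulrA !mulNr ii !mulNr !opprK !mul1r; apply/nesym.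
case: no_pair; exists i, j; split=> //; apply: anticomm_of_sqrN1 => //.
exact: tr0_sqr (ug_nm Uij) tij.
Qed.

End Dichotomy.

(** * Norm forms over the completions *)

Section CompletionZeros.

Variable nu : absval.

Lemma completion_pi_eq0 (u : cauchy_ring nu) :
  (\pi_(completion nu) u = 0)%qT <-> null_seq nu u.
Proof.
rewrite -[X in _ = X](@rmorph0 _ _ (\pi_(completion nu))%qT); split.
  by move/eqP; rewrite -Quotient.idealrBE subr0 => /asboolP.
by move=> nu_u; apply/eqP; rewrite -Quotient.idealrBE subr0; apply/asboolP.
Qed.

(** A bound of the coordinates by the norm passes to the completion, unlike mere anisotropy over Q:
    where the norms of the approximating terms tend to 0, all four coordinates become null
    sequences. *)
Lemma completion_aniso (a b C : rat) : 0 < C ->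
  (forall x0 x1 x2 x3 : rat, let N := C * nu (quat_norm a b x0 x1 x2 x3) in
    [/\ nu x0 ^+ 2 <= N, nu x1 ^+ 2 <= N, nu x2 ^+ 2 <= N & nu x3 ^+ 2 <= N]) ->
  forall x0 x1 x2 x3 : completion nu,
    quat_norm (to_completion nu a) (to_completion nu b) x0 x1 x2 x3 = 0 ->
    [/\ x0 = 0, x1 = 0, x2 = 0 & x3 = 0].
Proof.
move=> C0 bound; elim/quotW=> u0; elim/quotW=> u1; elim/quotW=> u2; elim/quotW=> u3.
rewrite /quat_norm /to_completion -!rmorphXn -!rmorphM -!rmorphB -rmorphD.
move/completion_pi_eq0 => N0.
have null (u : cauchy_ring nu) : (forall n, nu (u n) ^+ 2 <=
    C * nu (quat_norm a b (u0 n) (u1 n) (u2 n) (u3 n))) -> null_seq nu u.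
  move=> uN e e0; have eC : 0 < e ^+ 2 / C by rewrite divr_gt0 ?exprn_gt0.
  have [M HM] := N0 _ eC; exists M => n /HM; rewrite ltr_pdivlMr // mulrC => nC.
  rewrite -(@ltr_pXn2r _ 2) ?nnegrE ?absval_ge0 ?ltW //.
  by apply: le_lt_trans (uN n) _.
by split; apply/completion_pi_eq0/null => n; case: (bound (u0 n) (u1 n) (u2 n) (u3 n)).
Qed.

End CompletionZeros.

(** * Anisotropy of the norm form by p-adic descent *)

Section PadicIntegers.

Variables (p : nat) (p_pr : prime p).

Let p_gt0 : 0 < p%:R :> rat.
Proof. by rewrite ltr0n prime_gt0. Qed.

Lemma padic_abs_int (n : int) : n != 0 ->
  padic_abs p n%:~R = (p%:R ^+ logn p `|n|%N)^-1.
Proof.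
by move=> n0; have := padic_abs_frac p_pr n0 (oner_neq0 _); rewrite divr1 logn1 expr0 div1r.
Qed.

Lemma padic_abs_dvd m (n : int) : ((p%:Z ^+ m)%R %| n)%Z ->
  padic_abs p n%:~R <= (p%:R ^+ m)^-1.
Proof.
have [->|n0 pn] := eqVneq n 0; first by rewrite /padic_abs eqxx invr_ge0 exprn_ge0 // ltW.
rewrite padic_abs_int // lef_pV2 ?posrE ?exprn_gt0 // ler_weXn2l ?ler1n ?prime_gt0 //.
by rewrite -pfactor_dvdn ?absz_gt0 //; move: pn; rewrite dvdzE abszX.
Qed.

Lemma pexp_inv_lt (e : rat) : 0 < e -> exists N, forall n, (N <= n)%N -> (p%:R ^+ n)^-1 < e.
Proof.
move=> e0; exists (Num.bound e^-1) => n Nn.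
rewrite invf_plt ?posrE ?exprn_gt0 //; apply: lt_le_trans (_ : n%:R <= _).
  apply: lt_le_trans (archi_boundP _) _; first by rewrite invr_ge0 ltW.
  by rewrite ler_nat.
by rewrite -natrX ler_nat ltnW // ltn_expl // prime_gt1.
Qed.

End PadicIntegers.

Section PadicAnisotropy.

Variables (p : nat) (p_pr : prime p) (a b : int).
Local Notation Q := (quat_norm a b).
Hypothesis Qp3 : forall x0 x1 x2 x3, ((p%:Z ^+ 3)%R %| Q x0 x1 x2 x3)%Z ->
  [/\ (p %| x0)%Z, (p %| x1)%Z, (p %| x2)%Z & (p %| x3)%Z].

(** Each round divides all coordinates by p and hence the value of the form by p^2; the hypothesis
    [Qp3] applies as long as p^3 remains. *)
Lemma padic_descent m x0 x1 x2 x3 :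
  ((p%:Z ^+ m.*2.+1)%R %| Q x0 x1 x2 x3)%Z ->
  [/\ ((p%:Z ^+ m)%R %| x0)%Z, ((p%:Z ^+ m)%R %| x1)%Z,
      ((p%:Z ^+ m)%R %| x2)%Z & ((p%:Z ^+ m)%R %| x3)%Z].
Proof.
elim: m x0 x1 x2 x3 => [|m IH] x0 x1 x2 x3 dQ; first by rewrite expr0 !dvd1z.
have p0 : p%:Z != 0 by have := prime_gt0 p_pr; lia.
have [] := Qp3 (dvdz_trans (dvdz_exp2l _ (_ : 3 <= m.+1.*2.+1)%N) dQ).
  by rewrite doubleS.
case/dvdzP=> y0 e0; case/dvdzP=> y1 e1; case/dvdzP=> y2 e2; case/dvdzP=> y3 e3.
move: dQ; rewrite e0 e1 e2 e3.
have -> : Q (y0 * p) (y1 * p) (y2 * p) (y3 * p) = p%:Z ^+ 2 * Q y0 y1 y2 y3.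
  by rewrite /quat_norm; ring.
rewrite doubleS -[m.*2.+3]/(2 + m.*2.+1)%N exprD dvdz_mul2l ?expf_neq0 // => /IH[d0 d1 d2 d3].
by rewrite exprSr; split; rewrite dvdz_mul2r.
Qed.

Lemma padic_int_bound x0 x1 x2 x3 :
  let N := p%:R ^+ 2 * padic_abs p (Q x0 x1 x2 x3)%:~R in
  [/\ padic_abs p x0%:~R ^+ 2 <= N, padic_abs p x1%:~R ^+ 2 <= N,
      padic_abs p x2%:~R ^+ 2 <= N & padic_abs p x3%:~R ^+ 2 <= N].
Proof.
have p0 : 0 < p%:R :> rat by rewrite ltr0n prime_gt0.
have [Q0|Q0] /= := eqVneq (Q x0 x1 x2 x3) 0.
  have z x : (forall m, ((p%:Z ^+ m)%R %| x)%Z) -> padic_abs p x%:~R ^+ 2 <= 0.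
    move=> dx; suff -> : x = 0 by rewrite /padic_abs eqxx expr0n.
    apply: contrapT => /eqP x0'; have := dx `|x|%N.
    rewrite dvdzE abszX => /dvdn_leq; rewrite absz_gt0 => /(_ x0').
    by rewrite leqNgt ltn_expl // prime_gt1.
  rewrite Q0 {2 4 6 8}/padic_abs eqxx mulr0.
  by split; apply: z => m; case: (@padic_descent m x0 x1 x2 x3); rewrite ?Q0 ?dvdz0.
rewrite (padic_abs_int p_pr Q0); set e := logn p _.
(* For e > 0 this is the largest m with 2 m + 1 <= e, as the descent requires. The loss e - 2 m is
   at most 2, whence the constant p^2 in the bound. *)
pose m := e.-1./2.
have e_le : (e <= m.*2 + 2)%N.
  by rewrite /m; case: (e) => // n /=; rewrite -{1}(odd_double_half n); case: odd; lia.
have z x : ((p%:Z ^+ m)%R %| x)%Z ->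
    padic_abs p x%:~R ^+ 2 <= p%:R ^+ 2 * (p%:R ^+ e)^-1.
  move=> /(padic_abs_dvd p_pr) xm.
  apply: le_trans (_ : (p%:R ^+ m)^-1 ^+ 2 <= _).
    apply: lerXn2r xm; rewrite nnegrE; first exact: padic_abs_ge0.
    by rewrite invr_ge0 exprn_ge0 // ltW.
  rewrite exprVn -exprM muln2 ler_pdivlMr ?exprn_gt0 // mulrC ler_pdivrMr ?exprn_gt0 //.
  by rewrite -exprD addnC ler_weXn2l // ler1n prime_gt0.
suff dQ : (e != 0)%N -> ((p%:Z ^+ m.*2.+1)%R %| Q x0 x1 x2 x3)%Z.
  have [e0|/dQ/padic_descent[]] := eqVneq e 0%N; last by split; apply: z.
  have m0 : m = 0%N by rewrite /m e0.
  by split; apply: z; rewrite m0 expr0 dvd1z.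
move=> e0; rewrite dvdzE abszX pfactor_dvdn ?absz_gt0 // -/e /m.
by case: (e) e0 => // n _ /=; rewrite -{2}(odd_double_half n); case: odd; lia.
Qed.

Lemma padic_rat_bound (x0 x1 x2 x3 : rat) :
  let N := p%:R ^+ 2 * padic_abs p (quat_norm a%:~R b%:~R x0 x1 x2 x3) in
  [/\ padic_abs p x0 ^+ 2 <= N, padic_abs p x1 ^+ 2 <= N,
      padic_abs p x2 ^+ 2 <= N & padic_abs p x3 ^+ 2 <= N].
Proof.
(* A common denominator: both sides of the integral bound scale by |d|^2. *)
pose d := denq x0 * denq x1 * denq x2 * denq x3.
have d0 : (d%:~R != 0 :> rat) by rewrite intr_eq0 !mulf_neq0 ?denq_neq0.
have nd : 0 < padic_abs p d%:~R ^+ 2.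
  by rewrite exprn_gt0 // lt_def padic_abs_ge0 // padic_abs_eq0 // d0.
pose y0 := numq x0 * denq x1 * denq x2 * denq x3.
pose y1 := denq x0 * numq x1 * denq x2 * denq x3.
pose y2 := denq x0 * denq x1 * numq x2 * denq x3.
pose y3 := denq x0 * denq x1 * denq x2 * numq x3.
have e0 : y0%:~R = d%:~R * x0 by rewrite /y0 /d !intrM numqE; ring.
have e1 : y1%:~R = d%:~R * x1 by rewrite /y1 /d !intrM numqE; ring.
have e2 : y2%:~R = d%:~R * x2 by rewrite /y2 /d !intrM numqE; ring.
have e3 : y3%:~R = d%:~R * x3 by rewrite /y3 /d !intrM numqE; ring.
move: d y0 y1 y2 y3 d0 nd e0 e1 e2 e3 => d y0 y1 y2 y3 d0 nd e0 e1 e2 e3.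
have := padic_int_bound y0 y1 y2 y3 => /=.
have -> : (Q y0 y1 y2 y3)%:~R = d%:~R ^+ 2 * quat_norm a%:~R b%:~R x0 x1 x2 x3 :> rat.
  rewrite /quat_norm !(rmorphD, rmorphN, rmorphM, rmorphXn) /=.
  by rewrite e0 e1 e2 e3; ring.
rewrite e0 e1 e2 e3 expr2 !(padic_absM p_pr) -!expr2 !exprMn.
by rewrite [p%:R ^+ 2 * _]mulrCA !(ler_pM2l nd).
Qed.

Lemma ramified_of_descent (D : falgType rat) (i j : D) :
  i ^+ 2 = a%:~R%:A -> j ^+ 2 = b%:~R%:A -> j * i = - (i * j) ->
  a != 0 -> b != 0 -> basis_of {:D} [:: 1; i; j; i * j] ->
  ramified D (FinitePlace p_pr).
Proof.
move=> ii jj ji a0 b0 bB.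
have a0' : a%:~R != 0 :> rat by rewrite intr_eq0.
have b0' : b%:~R != 0 :> rat by rewrite intr_eq0.
apply/(division_scalar_extP _ ii jj ji a0' b0' (quat_span bB)).
apply: (@completion_aniso (padic_absval p_pr) _ _ (p%:R ^+ 2)).
  by rewrite exprn_gt0 // ltr0n prime_gt0.
exact: padic_rat_bound.
Qed.

End PadicAnisotropy.

(** * Hensel's lemma and zeros of the norm form *)

Section Hensel.

Variables (q : nat) (q_pr : prime q) (s c v0 m : int).
Local Notation f v := (v ^+ 2 + s * v + c).
Hypotheses (f_v0 : (q %| f v0)%Z) (m_inv : (q %| m * (2 * v0 + s) - 1)%Z).

Local Notation step := (fun v : int => v - m * f v).
Local Notation v_ n := (iter n step v0).

(** Newton iteration with the fixed slope m, an inverse of f'(v0) modulo q. As v stays congruent to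
    v0, f (v - m f v) is f v times a multiple of q, so each step gains one power of q. *)
Lemma hensel_step n : ((q%:Z ^+ n.+1)%R %| f (v_ n))%Z /\ (q %| v_ n - v0)%Z.
Proof.
elim: n => [|n [IH1 IH2]]; first by rewrite expr1 subrr dvdz0.
set v := v_ n in IH1 IH2; rewrite iterS -/v.
have qf : (q %| f v)%Z by apply: dvdz_trans IH1; rewrite exprS dvdz_mulr.
split.
  have -> : f (v - m * f v) =
      f v * (m ^+ 2 * f v - 2 * m * (v - v0) - (m * (2 * v0 + s) - 1)) by ring.
  have d1 : (q %| m ^+ 2 * f v)%Z by exact: dvdz_mull.
  have d2 : (q %| 2 * m * (v - v0))%Z by exact: dvdz_mull.
  by rewrite [q%:Z ^+ n.+2]exprSr dvdz_mul // rpredB // rpredB.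
have -> : v - m * f v - v0 = (v - v0) - m * f v by ring.
by rewrite rpredB //; exact: dvdz_mull.
Qed.

Lemma hensel_close N n k : (N <= n)%N -> ((q%:Z ^+ N)%R %| v_ (n + k) - v_ n)%Z.
Proof.
move=> Nn; elim: k => [|k IH]; first by rewrite addn0 subrr dvdz0.
rewrite addnS iterS; set v := v_ (n + k)%N in IH *.
have -> : v - m * f v - v_ n = (v - v_ n) - m * f v by ring.
have [fv _] := hensel_step (n + k); rewrite rpredB //; apply: dvdz_mull.
by apply: dvdz_trans fv; rewrite dvdz_exp2l //; lia.
Qed.

Lemma hensel_root : exists y : completion (padic_absval q_pr),
  y ^+ 2 + to_completion _ s%:~R * y + to_completion _ c%:~R = 0.
Proof.
have cv : cauchy_seq (padic_absval q_pr) (fun n => (v_ n)%:~R).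
  move=> e e0; have [N HN] := pexp_inv_lt q_pr e0.
  have close i k : (N <= i)%N -> padic_abs q ((v_ (i + k))%:~R - (v_ i)%:~R) < e.
    move=> Ni; apply: le_lt_trans (HN N (leqnn _)).
    by rewrite -intrB; apply: (padic_abs_dvd q_pr); exact: hensel_close.
  exists N => i j Ni Nj; have [ij|ji] := leqP i j.
    by rewrite -(subnKC ij) -(absvalN (padic_absval q_pr)) opprB; exact: close.
  by rewrite -(subnKC (ltnW ji)); exact: close.
have cvP : (fun n => (v_ n)%:~R) \in cauchy_pred (padic_absval q_pr) by apply/asboolP.
exists (\pi_(completion _) (CauchySeq cvP))%qT.
rewrite /to_completion -rmorphXn -rmorphM -!rmorphD; apply/completion_pi_eq0 => e e0.
have [N HN] := pexp_inv_lt q_pr e0; exists N => n Nn /=.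
apply: le_lt_trans (HN n Nn).
have [fv _] := hensel_step n.
rewrite [X in padic_abs q X](_ : _ = (f (v_ n))%:~R); last first.
  by rewrite !intrD intrM rmorphXn.
by apply: (padic_abs_dvd q_pr); apply: dvdz_trans fv; rewrite dvdz_exp2l.
Qed.

End Hensel.

(** Pigeonhole: x^2 and - c - y^2 each take (q + 1) / 2 values in a field with q elements. *)
Lemma sum_two_squares_modp (q : nat) (c : int) : prime q -> odd q ->
  exists x y : int, (q %| x ^+ 2 + y ^+ 2 + c)%Z.
Proof.
move=> q_pr q_odd; pose h := (q.+1)./2.
have q_ge3 : (2 < q)%N by case: q q_pr q_odd {h} => [|[|[|]]].
have hq : (h.*2 = q.+1)%N by rewrite /h -[in RHS](odd_double_half q.+1) /= q_odd.
have injsq (i j : 'I_h) : (i%:R : 'F_q) ^+ 2 = j%:R ^+ 2 -> i = j.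
  move=> /eqP; rewrite eqf_sqr => /orP[|].
    rewrite -(inj_eq val_inj) /= !val_Fp_nat ?prime_gt1 // !modn_small; last 2 first.
    - by have := ltn_ord j; lia.
    - by have := ltn_ord i; lia.
    by move=> /eqP/val_inj.
  rewrite -addr_eq0 -natrD -(inj_eq val_inj) /= val_Fp_nat // modn_small.
    by rewrite addn_eq0 => /andP[/eqP i0 /eqP j0]; apply: val_inj; rewrite /= i0 j0.
  have := ltn_ord i; have := ltn_ord j; lia.
pose S := [set (i%:R : 'F_q) ^+ 2 | i : 'I_h].
pose T := [set - c%:~R - (i%:R : 'F_q) ^+ 2 | i : 'I_h].
have cS : #|S| = h by rewrite card_imset ?card_ord // => i j; exact: injsq.
have cT : #|T| = h.
  by rewrite card_imset ?card_ord // => i j /addrI/oppr_inj; exact: injsq.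
have /set0Pn[z] : S :&: T != set0.
  apply/eqP => ST0; have := max_card (S :|: T).
  by rewrite cardsU ST0 cards0 subn0 cS cT addnn hq card_Fp // ltnn.
rewrite inE => /andP[/imsetP[i _ ->] /imsetP[j _ E]].
exists i, j; rewrite dvdzE (dvdn_pcharf (pchar_Fp q_pr)).
suff : (i%:Z ^+ 2 + j%:Z ^+ 2 + c)%:~R = 0 :> 'F_q.
  by case: (_ + c) => n; rewrite ?NegzE ?mulrNz => /eqP; rewrite ?oppr_eq0.
by rewrite !intrD !rmorphXn /= E subrK addrC subrr.
Qed.

Section NotRamified.

Variables (D : falgType rat) (q : nat) (q_pr : prime q) (a b : rat) (i j : D).
Hypotheses (ii : i ^+ 2 = a%:A) (jj : j ^+ 2 = b%:A) (ji : j * i = - (i * j)).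
Hypotheses (a0 : a != 0) (b0 : b != 0) (bB : basis_of {:D} [:: 1; i; j; i * j]).

Lemma not_ramified_of_zero (x0 x1 x2 x3 : completion (padic_absval q_pr)) :
  quat_norm (to_completion _ a) (to_completion _ b) x0 x1 x2 x3 = 0 ->
  x2 != 0 -> ~ ramified D (FinitePlace q_pr).
Proof.
move=> n0 /eqP x20 /(division_scalar_extP _ ii jj ji a0 b0 (quat_span bB)) aniso.
by case: (aniso _ _ _ _ n0) => _ _ /x20.
Qed.

(** At (x0, x1, 1, 0) the norm form is x0^2 + x1^2 + c. Since q does not divide c, one of x and y is
    prime to q, by symmetry y; then 2 y is invertible modulo q and y lifts to a root while x is
    kept. *)
Lemma not_ramified_of_hensel (c x y : int) : a = -1 -> b = - c%:~R ->
  odd q -> ~~ (q %| c)%Z -> (q %| x ^+ 2 + y ^+ 2 + c)%Z ->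
  ~ ramified D (FinitePlace q_pr).
Proof.
move=> aE bE q_odd qc qxy.
wlog qy : x y qxy / ~~ (q %| y)%Z.
  move=> wlog_y; have [qy|qy] := boolP (q %| y)%Z; last exact: wlog_y qxy qy.
  have [qx|qx] := boolP (q %| x)%Z; last first.
    by apply: (wlog_y y x) => //; rewrite [y ^+ 2 + _]addrC.
  case/negP: qc; have -> : c = (x ^+ 2 + y ^+ 2 + c) - x * x - y * y by ring.
  by rewrite rpredB // ?rpredB //; exact: dvdz_mulr.
have [m [n mn]] : exists m n : int, m * (2 * y) + n * q = 1.
  have cop : coprimez (2 * y) q.
    rewrite coprimezE abszM coprimeMl; apply/andP; split; first by rewrite coprime2n.
    by rewrite coprime_sym prime_coprime //; move: qy; rewrite dvdzE.
  by have [[m n] /= mn] := coprimezP _ _ cop; exists m, n.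
have [||z zE] := @hensel_root q q_pr 0 (x ^+ 2 + c) y m.
- by rewrite mul0r addr0 addrA [_ + x ^+ 2]addrC.
- have -> : m * (2 * y + 0) - 1 = - (n * q) by rewrite -[X in _ - X]mn; ring.
  by rewrite dvdzE abszN abszM dvdn_mull.
apply: (@not_ramified_of_zero (to_completion _ x%:~R) z 1 0); last exact: oner_neq0.
rewrite /quat_norm aE bE rmorphN1 rmorphN expr1n expr0n /= mulr0 addr0 -[RHS]zE.
by rewrite rmorph0 mul0r addr0 intrD !rmorphD !rmorphXn /=; ring.
Qed.

End NotRamified.

Lemma odd_prime_of_neq2 q : prime q -> q <> 2%N -> odd q.
Proof. by case/even_prime. Qed.

(** The squares are expressed linearly in fresh variables, so that [lia] can settle the sixteen
    cases of the descent at 2; the next lemma does the same for the descent at 3. *)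
Lemma sqr_mod8 (x : int) :
  (exists y z, x = 2 * y /\ x ^+ 2 = 4 * z) \/ (exists z, x ^+ 2 = 8 * z + 1).
Proof.
have := divz_eq x 4; have := modz_ge0 x (isT : 4 != 0 :> int).
have := ltz_pmod x (isT : 0 < 4 :> int).
move: (divz x 4) (modz x 4) => k r r4 r0 ->.
have [->|[->|[->|->]]] : r = 0 \/ r = 1 \/ r = 2 \/ r = 3 by lia.
- by left; exists (2 * k), (4 * k ^+ 2); split; ring.
- by right; exists (k * (2 * k + 1)); ring.
- by left; exists (2 * k + 1), ((2 * k + 1) ^+ 2); split; ring.
- by right; exists ((2 * k + 1) * (k + 1)); ring.
Qed.

Lemma sqr_mod9 (x : int) :
  (exists y z, x = 3 * y /\ x ^+ 2 = 9 * z) \/ (exists z, x ^+ 2 = 3 * z + 1).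
Proof.
have := divz_eq x 3; have := modz_ge0 x (isT : 3 != 0 :> int).
have := ltz_pmod x (isT : 0 < 3 :> int).
move: (divz x 3) (modz x 3) => k r r4 r0 ->.
have [->|[->|->]] : r = 0 \/ r = 1 \/ r = 2 by lia.
- by left; exists k, (k ^+ 2); split; ring.
- by right; exists (3 * k ^+ 2 + 2 * k); ring.
- by right; exists (3 * k ^+ 2 + 4 * k + 1); ring.
Qed.

(** Odd squares are 1 and even squares 0 or 4 modulo 8. Modulo 4 the number of odd coordinates is 0
    or 4, and four odd squares add up to 4 modulo 8. *)
Lemma quat_norm_descent2 (x0 x1 x2 x3 : int) :
  ((2%:Z ^+ 3)%R %| quat_norm (-1) (-1) x0 x1 x2 x3)%Z ->
  [/\ (2 %| x0)%Z, (2 %| x1)%Z, (2 %| x2)%Z & (2 %| x3)%Z].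
Proof.
have -> : quat_norm (-1) (-1) x0 x1 x2 x3 = x0 ^+ 2 + x1 ^+ 2 + x2 ^+ 2 + x3 ^+ 2.
  by rewrite /quat_norm; ring.
rewrite (_ : 2%:Z ^+ 3 = 8) // => /dvdzP[k].
have [[y0 [z0 [-> ->]]]|[z0 ->]] := sqr_mod8 x0;
have [[y1 [z1 [-> ->]]]|[z1 ->]] := sqr_mod8 x1;
have [[y2 [z2 [-> ->]]]|[z2 ->]] := sqr_mod8 x2;
have [[y3 [z3 [-> ->]]]|[z3 ->]] := sqr_mod8 x3 => sumE; try lia.
by split; exact: dvdz_mulr.
Qed.

(** Modulo 3 the form is x0^2 + x1^2, so 3 divides [x0] and [x1]; then modulo 9 the same argument
    applies to [x2] and [x3]. *)
Lemma quat_norm_descent3 (x0 x1 x2 x3 : int) :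
  ((3%:Z ^+ 3)%R %| quat_norm (-1) (-3) x0 x1 x2 x3)%Z ->
  [/\ (3 %| x0)%Z, (3 %| x1)%Z, (3 %| x2)%Z & (3 %| x3)%Z].
Proof.
have -> : quat_norm (-1) (-3) x0 x1 x2 x3 = x0 ^+ 2 + x1 ^+ 2 + 3 * x2 ^+ 2 + 3 * x3 ^+ 2.
  by rewrite /quat_norm; ring.
rewrite (_ : 3%:Z ^+ 3 = 27) // => /dvdzP[k].
have [[y0 [z0 [-> ->]]]|[z0 ->]] := sqr_mod9 x0;
have [[y1 [z1 [-> ->]]]|[z1 ->]] := sqr_mod9 x1;
have [[y2 [z2 [-> ->]]]|[z2 ->]] := sqr_mod9 x2;
have [[y3 [z3 [-> ->]]]|[z3 ->]] := sqr_mod9 x3 => sumE; try lia.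
by split; exact: dvdz_mulr.
Qed.

(** * Recognition of the two quaternion algebras *)

Section DpInfty.

Variables (D : falgType rat) (i j : D).
Hypotheses (defD : definite_quaternion_algebra D).
Hypotheses (ii : i * i = -1) (ji : j * i = - (i * j)).

Let ii' : i ^+ 2 = (-1)%:A. Proof. by rewrite expr2 ii scaleN1r. Qed.

Lemma definite_quat_basis (b : rat) : b != 0 -> j * j = b%:A ->
  basis_of {:D} [:: 1; i; j; i * j].
Proof.
case: defD => -[a' [b' [i0 [j0 [_ bB0]]]]] _ b0 jj.
have dimD : \dim {:D} = 4%N by rewrite (size_basis (X := in_tuple _) bB0).
exact: (@quat_basis _ _ _ _ (-1) b).
Qed.

Lemma is_D_2_infty : j * j = -1 -> is_D_p_infty 2 D.
Proof.
move=> jj; have jj' : j ^+ 2 = (-1)%:A by rewrite expr2 jj scaleN1r.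
have bB : basis_of {:D} [:: 1; i; j; i * j] by apply: (@definite_quat_basis (-1)).
case: defD => quatD ramD; split=> // q q_pr; split=> [ram|qE].
  apply: contrapT => /(odd_prime_of_neq2 q_pr) q_odd; move: ram.
  have [x [y qxy]] := sum_two_squares_modp 1 q_pr q_odd.
  apply: (not_ramified_of_hensel ii' jj' ji _ _ bB _ _ q_odd _ qxy) => //.
  by rewrite dvdzE dvdn1 /= neq_ltn prime_gt1 ?orbT.
subst q; apply: (@ramified_of_descent 2 q_pr (-1) (-1) _ D i j) => //.
exact: quat_norm_descent2.
Qed.

Lemma is_D_3_infty : j * j = (-3)%:A -> is_D_p_infty 3 D.
Proof.
move=> jj; have jj' : j ^+ 2 = (-3)%:A by rewrite expr2.
have bB : basis_of {:D} [:: 1; i; j; i * j] by apply: (@definite_quat_basis (-3)).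
case: defD => quatD ramD; split=> // q q_pr; split=> [ram|qE]; last first.
  subst q; apply: (@ramified_of_descent 3 q_pr (-1) (-3) _ D i j) => //.
  exact: quat_norm_descent3.
apply: contrapT => q3; move: ram.
have [q2|/(odd_prime_of_neq2 q_pr) q_odd] := pselect (q = 2%N); last first.
  have [x [y qxy]] := sum_two_squares_modp 3 q_pr q_odd.
  apply: (not_ramified_of_hensel ii' jj' ji _ _ bB _ _ q_odd _ qxy) => //.
  by rewrite dvdzE /= (dvdn_prime2 q_pr) //; apply/eqP.
(* At 2 the derivative 2 y used for odd primes is never a unit. Instead z is a root of v^2 + v + 2,
   whose value at 0 is 2 and whose derivative there is 1. *)
subst q; have [||z zE] := @hensel_root 2 q_pr 1 2 0 1 => //.
(* u^2 + u v + v^2 + 1 = 0 has the solution u = 1, v = z. *)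
apply: (@not_ramified_of_zero _ _ q_pr _ _ _ _ ii' jj' ji _ _ bB
  (z + to_completion _ (1 / 2)) 1 (to_completion _ (1 / 2)) 0) => //; last first.
  by rewrite fmorph_eq0.
rewrite /quat_norm -[RHS]zE; set e := to_completion _.
have -> : e 1%:~R = e (1 / 2) + e (1 / 2) by rewrite -rmorphD; congr (e _); field.
have -> : e 2%:~R = 1 + (e (1 / 2) + e (1 / 2)) ^+ 2.
  by rewrite -rmorphD -rmorphXn -[X in _ = X + _](rmorph1 e) -rmorphD; congr (e _); field.
rewrite /e !rmorphN rmorph1 rmorph_nat; ring.
Qed.

End DpInfty.

(** * Monomial form of imprimitive groups *)

Lemma ord2_cases (k : 'I_2) : k = 0 \/ k = 1.
Proof. by case: k => [[|[|//]]] lt2; [left|right]; apply: val_inj. Qed.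

Section DivisionRing.

Variable D : falgType rat.
Hypothesis divD : forall x : D, x != 0 -> exists2 y, y * x = 1 & x * y = 1.

Lemma scale_row_eq0 n (a : D) (v : 'rV[D]_n) : a *: v = 0 -> v != 0 -> a = 0.
Proof.
move=> av0 /eqP v0; apply: contrapT => /eqP /divD[y ya _]; apply: v0.
by rewrite -[v]scale1r -ya -scalerA av0 scaler0.
Qed.

(** Gaussian elimination over the skew field D: k is a pivot column of u, and [red] clears column k
    by subtracting a left multiple of u, which leaves only column l. *)
Lemma row2_span (u v : 'rV[D]_2) :
  (forall a b, a *: u + b *: v = 0 -> a = 0 /\ b = 0) ->
  forall w, exists a b, w = a *: u + b *: v.
Proof.
move=> indep w.
have one0 : (1 : D) != 0 by exact: oner_neq0.
have [k [l [kl uk]]] : exists k l : 'I_2, (forall m, m = k \/ m = l) /\ u 0 k != 0.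
  have [u0|] := eqVneq (u 0 0) 0; last first.
    by move=> u0; exists 0, 1; split; [exact: ord2_cases|exact: u0].
  have [u1|] := eqVneq (u 0 1) 0; last first.
    by move=> u1; exists 1, 0; split=> // k; case: (ord2_cases k); [right|left].
  case: (indep 1 0); last by move=> e; case/eqP: one0.
  rewrite scale1r scale0r addr0; apply/rowP => m; rewrite mxE.
  by case: (ord2_cases m) => ->.
have [a au ua] := divD uk.
pose red (x : 'rV[D]_2) := x - (x 0 k * a) *: u.
have redk x : red x 0 k = 0 by rewrite !mxE -mulrA au mulr1 subrr.
have dl : red v 0 l != 0.
  apply/eqP => redl; have redv : red v = 0.
    by apply/rowP => m; rewrite [RHS]mxE; case: (kl m) => ->.
  have [|_ e] := indep (- (v 0 k * a)) 1; last by case/eqP: one0.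
  by rewrite scaleNr scale1r addrC.
have [b bl _] := divD dl.
have wE : red w = (red w 0 l * b) *: red v.
  apply/rowP => m; rewrite [RHS]mxE; case: (kl m) => ->.
    by rewrite !redk mulr0.
  by rewrite -mulrA bl mulr1.
exists (w 0 k * a - red w 0 l * b * (v 0 k * a)), (red w 0 l * b).
move/eqP: wE; rewrite {1 3}/red subr_eq => /eqP {1}->.
by rewrite scalerBr scalerA scalerBl [LHS]addrC [RHS]addrAC addrA.
Qed.

Section DirectSum.

Variables (s : nat) (V : 'I_s -> {pred 'rV[D]_2}).
Hypothesis dsV : direct_sum_decomposition V.

Lemma direct_sum0 i : 0 \in V i.
Proof. by case: dsV => /(_ i)[]. Qed.

Lemma direct_sumZ i a v : v \in V i -> a *: v \in V i.
Proof.
case: dsV => /(_ i)[V0 VD] _ _ Vv.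
by have := VD a v 0 Vv V0; rewrite addr0.
Qed.

Lemma direct_sum_indep3 i j k u v w : i != j -> i != k -> j != k ->
  u \in V i -> v \in V j -> w \in V k -> u + v + w = 0 -> [/\ u = 0, v = 0 & w = 0].
Proof.
move=> ij ik jk Vu Vv Vw uvw; have [_ _ free] := dsV.
pose f m := if m == i then u else if m == j then v else if m == k then w else 0.
have fi : f i = u by rewrite /f eqxx.
have fj : f j = v by rewrite /f eq_sym (negbTE ij) eqxx.
have fk : f k = w by rewrite /f !(eq_sym k) (negbTE ik) (negbTE jk) eqxx.
have fV m : f m \in V m.
  by rewrite /f; do 3!case: eqP => [->//|_]; exact: direct_sum0.
have f0 : \sum_m f m = 0.
  rewrite (bigD1 i) //= (bigD1 j) /=; last by rewrite eq_sym.
  rewrite (bigD1 k) /=; last by rewrite !(eq_sym k) ik jk.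
  rewrite big1 => [|m /andP[/andP[mi mj] mk]]; last by rewrite /f !ifN.
  by rewrite fi fj fk addr0 addrA.
by have fz := free f fV f0; rewrite -fi -fj -fk !fz.
Qed.

Lemma direct_sum_indep2 i j u v : i != j ->
  u \in V i -> v \in V j -> u + v = 0 -> u = 0 /\ v = 0.
Proof.
move=> ij Vu Vv uv; have [_ _ free] := dsV.
pose f m := if m == i then u else if m == j then v else 0.
have fi : f i = u by rewrite /f eqxx.
have fj : f j = v by rewrite /f eq_sym (negbTE ij) eqxx.
have fV m : f m \in V m.
  by rewrite /f; do 2!case: eqP => [->//|_]; exact: direct_sum0.
have f0 : \sum_m f m = 0.
  rewrite (bigD1 i) //= (bigD1 j) /=; last by rewrite eq_sym.
  rewrite big1 => [|m /andP[mi mj]]; last by rewrite /f !ifN.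
  by rewrite fi fj addr0.
by have fz := free f fV f0; rewrite -fi -fj !fz.
Qed.

Lemma direct_sum_span i j u v : i != j -> u \in V i -> v \in V j ->
  u != 0 -> v != 0 ->
  (forall a b, a *: u + b *: v = 0 -> a = 0 /\ b = 0) /\
  (forall w, exists a b, w = a *: u + b *: v).
Proof.
move=> ij Vu Vv u0 v0; have indep a b : a *: u + b *: v = 0 -> a = 0 /\ b = 0.
  move=> /(direct_sum_indep2 ij (direct_sumZ a Vu) (direct_sumZ b Vv))[au bv].
  by split; [exact: scale_row_eq0 au u0|exact: scale_row_eq0 bv v0].
by split; last exact: row2_span.
Qed.

(** Nonzero vectors of two summands already span D^2, so a nonzero vector of a third summand would
    depend on them. *)
Lemma direct_sum_size : (1 < s)%N -> (forall i, exists2 v, v \in V i & v != 0) -> s = 2.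
Proof.
move=> s1 nz; apply/eqP; rewrite eqn_leq s1 andbT leqNgt; apply/negP => s2.
pose i := Ordinal (ltnW s1); pose j := Ordinal s1; pose k := Ordinal s2.
have [u Vu u0] := nz i; have [v Vv v0] := nz j; have [w Vw w0] := nz k.
have [_ /(_ w)[a [b wE]]] := direct_sum_span (isT : i != j) Vu Vv u0 v0.
have e : a *: u + b *: v + - w = 0 by rewrite -wE subrr.
have Vw' : - w \in V k by rewrite -scaleN1r direct_sumZ.
have [_ _ /eqP] := direct_sum_indep3 (isT : i != j) (isT : i != k) (isT : j != k)
  (direct_sumZ a Vu) (direct_sumZ b Vv) Vw' e.
by rewrite oppr_eq0 (negbTE w0).
Qed.

(** Each summand is thus a line: the component along v of a vector of [V i] lies in both [V i] and
    [V j]. *)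
Lemma direct_sum_sub i j u v w : i != j -> u \in V i -> v \in V j ->
  u != 0 -> v != 0 -> w \in V i -> exists a, w = a *: u.
Proof.
move=> ij Vu Vv u0 v0 Vw; have [_ /(_ w)[a [b wE]]] := direct_sum_span ij Vu Vv u0 v0.
have Vx : a *: u - w \in V i.
  case: dsV => /(_ i)[V0 VD] _ _; rewrite VD //.
  by rewrite -scaleN1r direct_sumZ.
have e : (a *: u - w) + b *: v = 0 by rewrite addrAC -wE subrr.
have [/subr0_eq <- _] := direct_sum_indep2 ij Vx (direct_sumZ b Vv) e.
by exists a.
Qed.

End DirectSum.

End DivisionRing.

Lemma fset_finite_order (R : nzRingType) (S : {fset R}) (x y : R) :
  y * x = 1 -> (forall k, x ^+ k \in S) -> exists2 m, (0 < m)%N & x ^+ m = 1.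
Proof.
move=> yx xS.
have [i [j [ij e]]] : exists i j, (i < j)%N /\ x ^+ i = x ^+ j.
  apply: contrapT => no.
  have inj : injective (fun k => x ^+ k).
    move=> i j e; case: (ltngtP i j) => // l; case: no; [by exists i, j|by exists j, i].
  have uS : uniq [seq x ^+ k | k <- iota 0 (size (enum_fset S)).+1].
    by rewrite (map_inj_uniq inj) iota_uniq.
  have sS : {subset [seq x ^+ k | k <- iota 0 (size (enum_fset S)).+1] <= enum_fset S}.
    by move=> z /mapP[k _ ->]; exact: xS.
  by have := uniq_leq_size uS sS; rewrite size_map size_iota ltnn.
exists (j - i)%N; first by rewrite subn_gt0.
have yx' : y ^+ i * x ^+ i = 1.
  elim: i {ij e} => [|i IH]; first by rewrite !expr0 mulr1.
  by rewrite exprSr exprS mulrA -(mulrA (y ^+ i)) yx mulr1.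
move: e; rewrite -[in RHS](subnKC (ltnW ij)) exprD => /(congr1 ( *%R (y ^+ i))).
by rewrite mulrA yx' mul1r.
Qed.

(** * The wreath product as a group of monomial matrices *)

Section Monomial.

Variables (D : falgType rat) (gT : finGroupType) (psi : gT -> D).
Hypotheses (psi_inj : injective psi) (psi1 : psi 1%g = 1).
Hypothesis psiM : forall x y, psi (x * y)%g = psi x * psi y.

Local Notation W := (wreath_product gT 2).

(** The base component is read at the column rather than at the row; with matrices acting on row
    vectors, this matches [wreath_act] and makes the map multiplicative. *)
Definition monomial_mx (w : W) : 'M[D]_2 :=
  \matrix_(i, j) if j == w.1 i then psi (w.2 j) else 0.

Lemma monomial_mxM u v : monomial_mx (u * v)%g = monomial_mx u *m monomial_mx v.
Proof.
apply/matrixP => i j; rewrite !mxE (bigD1 (u.1 i)) //= big1 => [|k ki]; last first.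
  by rewrite !mxE (negbTE ki) mul0r.
rewrite !mxE eqxx addr0 permM; case: eqP => [->|_]; last by rewrite mulr0.
by rewrite !ffunE permK psiM.
Qed.

Lemma psi_neq0 x : psi x != 0.
Proof.
apply/eqP => x0; have := oner_neq0 D.
by rewrite -psi1 -(mulgV x) psiM x0 mul0r eqxx.
Qed.

Lemma monomial_mx_inj : injective monomial_mx.
Proof.
move=> u v /matrixP e.
have e1 i : u.1 i = v.1 i.
  have := e i (u.1 i); rewrite !mxE eqxx; case: eqP => // _ /eqP.
  by rewrite (negbTE (psi_neq0 _)).
have e2 j : u.2 j = v.2 j.
  have := e ((u.1)^-1 j)%g j; rewrite !mxE -e1 permKV eqxx; exact: psi_inj.
have E1 : u.1 = v.1 by apply/permP.
have E2 : u.2 = v.2 by apply/ffunP.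
by apply: val_inj; rewrite /= [LHS]surjective_pairing E1 E2 -surjective_pairing.
Qed.

Lemma monomial_mx1 : monomial_mx 1%g = 1%:M.
Proof.
apply/matrixP => i j; rewrite !mxE perm1 eq_sym; case: eqP => // _.
by rewrite ffunE psi1.
Qed.

Variables (B C : 'M[D]_2).
Hypotheses (CB : C *m B = 1%:M) (BC : B *m C = 1%:M).

Definition monomial_conj (w : W) : 'M[D]_2 := C *m monomial_mx w *m B.

Lemma monomial_conjM u v : monomial_conj (u * v)%g = monomial_conj u *m monomial_conj v.
Proof.
rewrite /monomial_conj monomial_mxM !mulmxA; congr (_ *m _).
by rewrite -(mulmxA (C *m monomial_mx u) B C) BC mulmx1.
Qed.

Lemma monomial_conj1 : monomial_conj 1%g = 1%:M.
Proof. by rewrite /monomial_conj monomial_mx1 mulmx1. Qed.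

Lemma monomial_conj_inj : injective monomial_conj.
Proof.
move=> u v e; have : B *m monomial_conj u *m C = B *m monomial_conj v *m C by rewrite e.
rewrite /monomial_conj !mulmxA BC !mul1mx.
by rewrite -!mulmxA BC !mulmx1 => /monomial_mx_inj.
Qed.

Lemma maximal_monomial (G : {fset 'M[D]_2}) : maximal_finite_subgroup G ->
  (forall g, g \in G -> exists w, g = monomial_conj w) ->
  group_isomorphic G (wreath_product gT 2).
Proof.
case=> _ maxG Gmono; exists monomial_conj; split.
- exact: monomial_conj_inj.
- exact: monomial_conjM.
pose H := [fset monomial_conj w | w in W]%fset.
have HP g : reflect (exists w, g = monomial_conj w) (g \in H).
  apply: (iffP (imfsetP _ _ _ _)) => [[w _ ->]|[w ->]]; by exists w.
have fH : finite_subgroup H.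
  split.
  - by apply/HP; exists 1%g; rewrite monomial_conj1.
  - by move=> _ _ /HP[u ->] /HP[v ->]; apply/HP; exists (u * v)%g; rewrite monomial_conjM.
  move=> _ /HP[u ->]; exists (monomial_conj u^-1%g); first by apply/HP; exists u^-1%g.
  by rewrite -!monomial_conjM mulgV mulVg monomial_conj1.
have <- : H = G by apply: maxG => // g /Gmono/HP.
by move=> g; split=> /HP.
Qed.

End Monomial.

(** Scaling multiplies the entries on the left and does not pass through X in general; it does here
    because rational scalars are central. *)
Lemma mulmx_scale_alg (D : algType rat) m n p (k : rat)
    (X : 'M[D]_(m, n)) (Y : 'M[D]_(n, p)) :
  X *m (k%:A *: Y) = k%:A *: (X *m Y).
Proof.
apply/matrixP => i j; rewrite !mxE mulr_sumr; apply: eq_bigr => l _.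
by rewrite !mxE !mulr_algl scalerAr.
Qed.

(** * The group of entries of an imprimitive group *)

Section Imprimitive.

Variables (D : falgType rat) (G : {fset 'M[D]_2}).
Hypothesis divD : forall x : D, x != 0 -> exists2 y, y * x = 1 & x * y = 1.
Hypothesis fG : finite_subgroup G.

(* Row i of B spans the i-th summand of the system of imprimitivity; the rows are
   chosen so that some element of G maps the first to the second. *)
Lemma imprimitive_frame : imprimitive G ->
  exists B C : 'M[D]_2, [/\ C *m B = 1%:M, B *m C = 1%:M,
    (exists2 g, g \in G & row 0 B *m g = row 1 B) &
    {in G, forall g, exists (t : 'S_2) (a : 'I_2 -> D),
       forall i, row i B *m g = a i *: row (t i) B}].
Proof.
case=> [[_ irrG]] [s [V [s1 dsV nzV permV]]].
have s2 := direct_sum_size divD dsV s1 nzV; subst s.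
have [G1 GM GV] := fG.
(* Otherwise every element of G maps [V 0] to itself, against irreducibility. *)
have [g0 Gg0 swap] : exists2 g, g \in G & forall v, (v *m g \in V 1) = (v \in V 0).
  apply: contrapT => no.
  have stable g v : g \in G -> v \in V 0 -> v *m g \in V 0.
    move=> Gg V0v; have [t tE] := permV g Gg; have := tE 0 v; rewrite V0v.
    suff -> : t 0 = 0 by [].
    have : t 0 != 1 by apply/eqP => t1; case: no; exists g => // w; rewrite -(tE 0) t1.
    by case: (ord2_cases (t 0)) => ->; rewrite ?eqxx.
  have sub0 : submod_closed (V 0) by case: dsV.
  have [v V0v /eqP v0] := nzV 0; have [w V1w w0] := nzV 1.
  case: (irrG (V 0) sub0 stable) => [/(_ v V0v)//|/(_ (- w)) V0w].
  have [_ w0'] := direct_sum_indep2 dsV (isT : 0 != 1 :> 'I_2) V0w V1w (addNr w).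
  by rewrite w0' eqxx in w0.
have [u V0u u0] := nzV 0; pose v := u *m g0.
have V1v : v \in V 1 by rewrite swap.
have v0 : v != 0.
  have [h _ [gh _]] := GV g0 Gg0; apply: contra_neq u0 => v0.
  by rewrite -(mulmx1 u) -gh mulmxA -/v v0 mul0mx.
have [indep span] := direct_sum_span divD dsV (isT : 0 != 1 :> 'I_2) V0u V1v u0 v0.
pose B : 'M[D]_2 := \matrix_(i < 2) (if i == 0 then u else v).
have B0 : row 0 B = u by rewrite rowK.
have B1 : row 1 B = v by rewrite rowK.
have rowB (x : 'rV[D]_2) : x *m B = x 0 0 *: u + x 0 1 *: v.
  rewrite mulmx_sum_row !big_ord_recl big_ord0 addr0 (_ : lift _ _ = 1); last exact: val_inj.
  by rewrite B1 -[ord0]/(0 : 'I_2) B0.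
have /choice[c cE] : forall i, exists x : 'rV[D]_2, row i (1%:M : 'M[D]_2) = x *m B.
  move=> i; have [a [b ->]] := span (row i 1%:M).
  by exists (\row_j if j == 0 then a else b); rewrite rowB !mxE.
pose C : 'M[D]_2 := \matrix_i c i.
have CB : C *m B = 1%:M by apply/row_matrixP => i; rewrite row_mul rowK -cE.
have injB (x : 'rV[D]_2) : x *m B = 0 -> x = 0.
  rewrite rowB => /indep[x0 x1]; apply/rowP => j; rewrite mxE.
  by case: (ord2_cases j) => ->.
(* Over the noncommutative D this is deduced from [CB] by the injectivity of x |-> x B. *)
have BC : B *m C = 1%:M.
  apply/row_matrixP => i; apply/subr0_eq/injB.
  by rewrite mulmxBl -!row_mul -mulmxA CB mulmx1 mul1mx subrr.
exists B, C; split=> //; first by exists g0; rewrite // B0 B1.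
have VB i : row i B \in V i.
  by case: (ord2_cases i) => ->; rewrite ?B0 ?B1.
have V_B i x : x \in V i -> exists a, x = a *: row i B.
  have [->|i0] := eqVneq i 0.
    by rewrite B0; exact: (direct_sum_sub divD dsV (isT : 0 != 1 :> 'I_2) V0u V1v u0 v0).
  have -> : i = 1 by case: (ord2_cases i) i0 => -> //; rewrite eqxx.
  by rewrite B1; exact: (direct_sum_sub divD dsV (isT : 1 != 0 :> 'I_2) V1v V0u v0 u0).
move=> g Gg; have [t tE] := permV g Gg.
have /choice[a aE] : forall i, exists a, row i B *m g = a *: row (t i) B.
  by move=> i; apply: V_B; rewrite tE VB.
by exists t, a.
Qed.

Variables B C : 'M[D]_2.
Hypotheses (CB : C *m B = 1%:M) (BC : B *m C = 1%:M).
Hypothesis swapG : exists2 g, g \in G & row 0 B *m g = row 1 B.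
Hypothesis monoG : {in G, forall g, exists (t : 'S_2) (a : 'I_2 -> D),
  forall i, row i B *m g = a i *: row (t i) B}.

(** The scalars by which the stabilizer in G of the first line acts on its basis vector; this is the
    group of entries U. *)
Definition block_units (x : D) : Prop := exists2 g, g \in G & row 0 B *m g = x *: row 0 B.

Lemma frame_inj (x y : 'rV[D]_2) : x *m B = y *m B -> x = y.
Proof. by move=> /(congr1 (mulmxr C)) /=; rewrite -!mulmxA BC !mulmx1. Qed.

Lemma frame_scale_inj i (a b : D) : a *: row i B = b *: row i B -> a = b.
Proof.
rewrite !rowE !scalemxAl => /frame_inj /rowP/(_ i).
by rewrite !mxE !eqxx !mulr1.
Qed.

(** The element s maps the first frame vector exactly to the second. Multiplying g by s on the left,
    by s^-1 on the right, or both, brings any entry to position (0, 0) unchanged. *)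
Lemma block_units_entry g t a : g \in G ->
  (forall i, row i B *m g = a i *: row (t i) B) -> forall i, block_units (a i).
Proof.
move=> Gg aE; have [_ GM GV] := fG; have [s Gs sE] := swapG.
have [h Gh [sh hs]] := GV s Gs.
have hE : row 1 B *m h = row 0 B by rewrite -sE -mulmxA sh mulmx1.
move=> i; case: (ord2_cases i) (ord2_cases (t i)) (aE i) => -> [] -> E.
- by exists g.
- by exists (g *m h); rewrite ?GM // mulmxA E -scalemxAl hE.
- by exists (s *m g); rewrite ?GM // mulmxA sE E.
by exists (s *m g *m h); rewrite ?GM // !mulmxA sE E -scalemxAl hE.
Qed.

Lemma block_units_group : absolutely_irreducible G -> unit_group block_units.
Proof.
move=> spanG; have [G1 GM GV] := fG.
have UV x : block_units x -> exists2 y, block_units y & y * x = 1 /\ x * y = 1.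
  case=> g Gg gE; have [h Gh [gh hg]] := GV g Gg.
  have x0 : x != 0.
    apply/eqP => x0; have : (1 : D) = 0; last by move/eqP; rewrite oner_eq0.
    apply: (@frame_scale_inj 0).
    by rewrite scale1r -[LHS]mulmx1 -gh mulmxA gE x0 !scale0r mul0mx.
  have [y yx xy] := divD x0; exists y => //; exists h => //.
  have : (y *: (row 0 B *m g)) *m h = y *: row 0 B by rewrite -scalemxAl -mulmxA gh mulmx1.
  by rewrite gE scalerA yx scale1r.
split.
- by exists 1%:M; rewrite // mulmx1 scale1r.
- move=> x y [g Gg gE] [h Gh hE]; exists (g *m h); rewrite ?GM //.
  by rewrite mulmxA gE -scalemxAl hE scalerA.
- by move=> x /UV[y Uy [yx xy]]; exists y.
- move=> x Ux; have [y _ [yx _]] := UV x Ux; case: Ux => g Gg gE.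
  have Gpow k : g ^+ k \in G by elim: k => [|k IH]; rewrite ?expr0 // exprS; exact: GM.
  have powE k : row 0 B *m (g ^+ k) = x ^+ k *: row 0 B.
    elim: k => [|k IH]; first by rewrite !expr0 scale1r mulmx1.
    by rewrite exprSr -mulmxE mulmxA IH -scalemxAl gE scalerA -exprSr.
  have [h _ [_ hg]] := GV g Gg.
  have [m m0 gm] := fset_finite_order (hg : h * g = 1) Gpow.
  exists m => //; apply: (@frame_scale_inj 0).
  by rewrite -powE gm mulmx1 scale1r.
(* The matrix with y at (0, 0) in the frame is a rational combination of elements of G, so y is one
   of their (0, 0) entries. These are 0 or in U, hence whatever centralizes U commutes with y. *)
move=> x xU y; pose X := C *m (y *: delta_mx 0 0) *m B.
have [c XE] := spanG X.
have BX : row 0 B *m X = y *: row 0 B.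
  rewrite /X -row_mul !mulmxA BC mul1mx row_mul linearZ -scalemxAl /=; congr (_ *: _).
  have -> : row 0 (delta_mx 0 0 : 'M[D]_2) = row 0 1%:M.
    by apply/rowP => j; rewrite !mxE eqxx eq_sym.
  by rewrite -row_mul mul1mx.
have yE : y = \sum_(g <- G) (c g)%:A * (row 0 B *m g *m C) 0 0.
  have <- : (row 0 B *m X *m C) 0 0 = y by rewrite BX -scalemxAl -row_mul BC !mxE eqxx mulr1.
  rewrite XE mulmx_sumr mulmx_suml summxE.
  by apply: eq_bigr => g _; rewrite mulmx_scale_alg -scalemxAl mxE.
have entry g : g \in G -> x * (row 0 B *m g *m C) 0 0 = (row 0 B *m g *m C) 0 0 * x.
  move=> Gg; have [t [a aE]] := monoG Gg.
  have -> : (row 0 B *m g *m C) 0 0 = if t 0 == 0 then a 0 else 0.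
    by rewrite aE -scalemxAl -row_mul BC !mxE; case: eqP => _; rewrite (mulr1, mulr0).
  by case: eqP => _; [apply: xU; exact: block_units_entry aE 0 | rewrite mulr0 mul0r].
rewrite yE mulr_sumr mulr_suml; apply: eq_big_seq => g Gg.
by rewrite !mulr_algl -scalerAr -scalerAl entry.
Qed.

Lemma block_units_wreath (gT : finGroupType) (psi : gT -> D) :
  maximal_finite_subgroup G -> injective psi ->
  (forall x y, psi (x * y)%g = psi x * psi y) ->
  (forall x, block_units x -> exists u, x = psi u) ->
  group_isomorphic G (wreath_product gT 2).
Proof.
move=> maxG psi_inj psiM psiU; have [G1 GM GV] := fG.
have psi1 : psi 1%g = 1.
  have [|u uE] := psiU 1; first by exists 1%:M; rewrite // mulmx1 scale1r.
  by rewrite -[LHS]mulr1 uE -psiM mul1g.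
apply: (maximal_monomial psi_inj psi1 psiM CB BC maxG) => g Gg.
have [t [a aE]] := monoG Gg.
have /choice[u uE] : forall i, exists x, a i = psi x.
  by move=> i; apply: psiU; exact: block_units_entry aE i.
(* The entry of row i stands in column t i, and [monomial_mx] reads the base component at the
   column. *)
pose phi : {dffun forall i : 'I_2, gT} := [ffun j => u (t^-1 j)%g].
have wP : (t, phi) \in setX [set: 'S_2] [set: {dffun forall i : 'I_2, gT}].
  by rewrite !inE.
exists (SdPair _ wP); rewrite -[LHS]mul1mx -CB -mulmxA /monomial_conj -mulmxA.
congr (_ *m _).
apply/row_matrixP => i; rewrite !row_mul aE uE.
have -> : row i (monomial_mx psi (SdPair _ wP)) = psi (u i) *: row (t i) 1%:M.
  apply/rowP => j; rewrite !mxE /= eq_sym; case: eqP => [<-|_]; last by rewrite mulr0.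
  by rewrite ffunE permK mulr1.
by rewrite -scalemxAl -row_mul mul1mx.
Qed.

End Imprimitive.

Theorem imprimitive_unit_group (D : falgType rat) (G : {fset 'M[D]_2}) :
  (forall x : D, x != 0 -> exists2 y, y * x = 1 & x * y = 1) ->
  maximal_finite_subgroup G -> absolutely_irreducible G -> imprimitive G ->
  exists2 U : D -> Prop, unit_group U &
    forall (gT : finGroupType) (psi : gT -> D), injective psi ->
      (forall x y, psi (x * y)%g = psi x * psi y) ->
      (forall x, U x -> exists u, x = psi u) ->
      group_isomorphic G (wreath_product gT 2).
Proof.
move=> divD maxG spanG impG; have [fG _] := maxG.
have [B [C [CB BC swapG monoG]]] := imprimitive_frame divD fG impG.
exists (block_units G B); first exact: (block_units_group divD fG BC swapG monoG spanG).
move=> gT psi psi_inj psiM.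
exact: (block_units_wreath fG CB BC swapG monoG maxG psi_inj psiM).
Qed.

(** * Hurwitz units *)

(** Matrices and quaternions are encoded as plain tuples, so that the finite checks below can be run
    by [vm_compute]. *)
Definition mat2 := ('F_3 * 'F_3 * 'F_3 * 'F_3)%type.
Definition int4 := (int * int * int * int)%type.

Definition mat2_mul (A B : mat2) : mat2 :=
  let: (a, b, c, d) := A in let: (a', b', c', d') := B in
  (a * a' + b * c', a * b' + b * d', c * a' + d * c', c * b' + d * d').

Definition mat2_det (A : mat2) : 'F_3 := let: (a, b, c, d) := A in a * d - b * c.

Definition int4_mul (x y : int4) : int4 :=
  let: (x0, x1, x2, x3) := x in let: (y0, y1, y2, y3) := y in
  (x0 * y0 - x1 * y1 - x2 * y2 - x3 * y3, x0 * y1 + x1 * y0 + x2 * y3 - x3 * y2,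
   x0 * y2 + x2 * y0 - x1 * y3 + x3 * y1, x0 * y3 + x3 * y0 + x1 * y2 - x2 * y1).

Definition F3_lift (x : 'F_3) : int := if x == 0 then 0 else if x == 1 then 1 else -1.

(* Modulo 3 the Hurwitz order becomes 'M['F_3]_2, with i and j acting as
   [[0, 1], [-1, 0]] and [[1, 1], [1, -1]]; the x_k are the coordinates of a matrix in
   the images of 1, i, j, ij. The value is twice the coordinates of the Hurwitz unit
   with that reduction: a unit has exactly one nonzero coordinate or four, in which
   case these are 1/2 or -1/2, that is -1 or 1 modulo 3. *)
Definition hurwitz_lift (A : mat2) : int4 :=
  let: (a, b, c, d) := A in
  let: (x0, x1, x2, x3) := (- (a + d), c - b, a - d + b + c, a - d - b - c) in
  let k : int := if [&& x0 != 0, x1 != 0, x2 != 0 & x3 != 0] then -1 else 2 in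
  (k * F3_lift x0, k * F3_lift x1, k * F3_lift x2, k * F3_lift x3).

Definition F3_elts : seq 'F_3 := [:: 0; 1; -1].

Definition SL2_F3_elts : seq mat2 :=
  let P := [seq (a, b) | a <- F3_elts, b <- F3_elts] in
  [seq A <- [seq (x.1, x.2, y.1, y.2) | x <- P, y <- P] | mat2_det A == 1].

Definition int4_double (x : int4) : int4 :=
  let: (x0, x1, x2, x3) := x in (2 * x0, 2 * x1, 2 * x2, 2 * x3).

Definition int4_sqr (x : int4) : int :=
  let: (x0, x1, x2, x3) := x in x0 ^+ 2 + x1 ^+ 2 + x2 ^+ 2 + x3 ^+ 2.

Definition small_ints : seq int := [:: -2; -1; 0; 1; 2].

Definition small_int4 : seq int4 :=
  let P := [seq (a, b) | a <- small_ints, b <- small_ints] in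
  [seq (x.1, x.2, y.1, y.2) | x <- P, y <- P].

Lemma mem_F3_elts (x : 'F_3) : x \in F3_elts.
Proof. by case: x => [[|[|[|]]]]. Qed.

Lemma mem_SL2_F3_elts A : mat2_det A = 1 -> A \in SL2_F3_elts.
Proof.
case: A => [[[a b] c] d] detA; rewrite mem_filter detA eqxx andTb.
apply/allpairsP; exists ((a, b), (c, d)); split; last by [].
  by apply/allpairsP; exists (a, b); split; rewrite ?mem_F3_elts.
by apply/allpairsP; exists (c, d); split; rewrite ?mem_F3_elts.
Qed.

(** Lifts carry doubled coordinates, so the product of two of them is four times the product of the
    units, that is, twice its lift. All pairs from the 24 matrices are checked. *)
Lemma hurwitz_liftM A B : mat2_det A = 1 -> mat2_det B = 1 ->
  int4_mul (hurwitz_lift A) (hurwitz_lift B) = int4_double (hurwitz_lift (mat2_mul A B)).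
Proof.
move=> /mem_SL2_F3_elts AL /mem_SL2_F3_elts BL.
have /allP/(_ A AL)/allP/(_ B BL)/eqP // : all (fun A => all (fun B =>
    int4_mul (hurwitz_lift A) (hurwitz_lift B) ==
    int4_double (hurwitz_lift (mat2_mul A B))) SL2_F3_elts) SL2_F3_elts.
by vm_compute.
Qed.

Lemma hurwitz_lift_inj A B : mat2_det A = 1 -> mat2_det B = 1 ->
  hurwitz_lift A = hurwitz_lift B -> A = B.
Proof.
move=> /mem_SL2_F3_elts AL /mem_SL2_F3_elts BL /eqP AB.
have /allP/(_ A AL)/allP/(_ B BL)/implyP/(_ AB)/eqP // : all (fun A => all (fun B =>
    (hurwitz_lift A == hurwitz_lift B) ==> (A == B)) SL2_F3_elts) SL2_F3_elts.
by vm_compute.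
Qed.

(** The tuples in question are the eight with a single nonzero coordinate 2 or -2 and the sixteen
    with all coordinates 1 or -1. *)
Lemma hurwitz_lift_surj x : x \in small_int4 -> int4_sqr x = 4 ->
  exists2 A, mat2_det A = 1 & hurwitz_lift A = x.
Proof.
move=> xs /eqP x4.
have /allP/(_ x xs)/implyP/(_ x4)/hasP[A] : all (fun x => (int4_sqr x == 4) ==>
    has (fun A => hurwitz_lift A == x) SL2_F3_elts) small_int4 by vm_compute.
by rewrite mem_filter => /andP[/eqP detA _] /eqP Ax; exists A.
Qed.

Definition mat2_of_mx (M : 'M['F_3]_2) : mat2 := (M 0 0, M 0 1, M 1 0, M 1 1).

Lemma sum_ord2 (R : nmodType) (f : 'I_2 -> R) : \sum_i f i = f 0 + f 1.
Proof.
rewrite !big_ord_recl big_ord0 addr0 -[ord0]/(0 : 'I_2); congr (_ + f _).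
exact: val_inj.
Qed.

Lemma mat2_of_mxM M N : mat2_of_mx (M *m N) = mat2_mul (mat2_of_mx M) (mat2_of_mx N).
Proof. by rewrite /mat2_of_mx !mxE !sum_ord2. Qed.

Lemma mat2_of_mx_det M : mat2_det (mat2_of_mx M) = \det M.
Proof.
rewrite (expand_det_row _ 0) sum_ord2 /cofactor !det_mx11 !mxE /= expr0 expr1 mul1r.
rewrite mulN1r mulrN; congr (_ * M _ _ - _ * M _ _); exact: val_inj.
Qed.

Lemma mat2_of_mx_inj : injective mat2_of_mx.
Proof.
move=> M N [e00 e01 e10 e11]; apply/matrixP => i j.
by case: (ord2_cases i) (ord2_cases j) => -> [] ->.
Qed.

Lemma mx_of_mat2 A : exists M, mat2_of_mx M = A.
Proof.
case: A => [[[a b] c] d].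
exists (\matrix_(i, j) if i == 0 then if j == 0 then a else b else if j == 0 then c else d).
by rewrite /mat2_of_mx !mxE.
Qed.

Section HurwitzUnits.

Variables (D : algType rat) (i j : D).
Hypotheses (ii : i ^+ 2 = (-1)%:A) (jj : j ^+ 2 = (-1)%:A) (ji : j * i = - (i * j)).

Definition half_quat (x : int4) : D := let: (x0, x1, x2, x3) := x in
  quat i j (x0%:~R / 2) (x1%:~R / 2) (x2%:~R / 2) (x3%:~R / 2).

Lemma half_quatM x y z : int4_mul x y = int4_double z ->
  half_quat x * half_quat y = half_quat z.
Proof.
case: x => [[[x0 x1] x2] x3]; case: y => [[[y0 y1] y2] y3]; case: z => [[[z0 z1] z2] z3].
move=> [e0 e1 e2 e3]; rewrite /half_quat (quatM ii jj ji).
have half (n m : int) : 2 * m = n -> m%:~R / 2 = n%:~R / 4 :> rat.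
  by move=> <-; rewrite intrM; field.
rewrite (half _ _ (esym e0)) (half _ _ (esym e1)) (half _ _ (esym e2)) (half _ _ (esym e3)).
by congr quat; rewrite !(rmorphD, rmorphN, rmorphM) /=; field.
Qed.

Lemma half_quat_inj : injective half_quat.
Proof.
case=> [[[x0 x1] x2] x3] [[[y0 y1] y2] y3] e.
have half (n m : int) : n%:~R / 2 + -1 * (m%:~R / 2) = 0 :> rat -> n = m.
  by move=> nm; apply: (@intr_inj rat); lra.
have : half_quat (x0, x1, x2, x3) + -1 *: half_quat (y0, y1, y2, y3) = 0.
  by rewrite e scaleN1r subrr.
rewrite quatZ quatD => /(quat_eq0 ii jj ji)[]// /half-> /half-> /half-> /half->.
by [].
Qed.

Definition hurwitz_unit (g : [subg SL2_F3_group]) : D :=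
  half_quat (hurwitz_lift (mat2_of_mx (GLval (sgval g)))).

Lemma SL2_F3_det (g : [subg SL2_F3_group]) : mat2_det (mat2_of_mx (GLval (sgval g))) = 1.
Proof. by rewrite mat2_of_mx_det; have := subgP g; rewrite inE => /eqP. Qed.

Lemma hurwitz_unitM g h : hurwitz_unit (g * h)%g = hurwitz_unit g * hurwitz_unit h.
Proof.
symmetry; apply: half_quatM; rewrite hurwitz_liftM ?SL2_F3_det //.
by rewrite -mat2_of_mxM.
Qed.

Lemma hurwitz_unit_inj : injective hurwitz_unit.
Proof.
move=> g h /half_quat_inj/hurwitz_lift_inj; rewrite !SL2_F3_det => /(_ erefl erefl).
by move/mat2_of_mx_inj => e; apply: val_inj; apply: val_inj; exact: e.
Qed.

Lemma hurwitz_unit_surj x : x \in small_int4 -> int4_sqr x = 4 ->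
  exists g, half_quat x = hurwitz_unit g.
Proof.
move=> xs /(hurwitz_lift_surj xs)[A detA <-]; have [M MA] := mx_of_mat2 A.
have detM : \det M = 1 by rewrite -mat2_of_mx_det MA.
have uM : M \is a GRing.unit by rewrite [_ \is a _]unitmxE detM unitr1.
pose g : {'GL_2['F_3]} := FinRing.unit _ uM.
have gS : g \in SL2_F3_group by rewrite inE /= detM.
by exists (subg _ g); rewrite /hurwitz_unit subgK // -MA.
Qed.

End HurwitzUnits.

(** * The dicyclic group of order 12 *)

(* (k, e) stands for a ^ k * b ^ e. *)
Definition dic12 : Type := ('Z_6 * bool)%type.

HB.instance Definition _ := Finite.on dic12.

(** The normal form of a^k b^e a^l b^f obtained from b a = a^-1 b and b^2 = a^3. *)
Definition dic12_mul (u v : dic12) : dic12 :=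
  (u.1 + (if u.2 then - v.1 else v.1) + (if u.2 && v.2 then 3%:R else 0), u.2 (+) v.2).

Definition dic12_inv (u : dic12) : dic12 := (if u.2 then u.1 + 3%:R else - u.1, u.2).

Fact Z6_opp3 : - 3%:R = 3%:R :> 'Z_6.
Proof. exact: val_inj. Qed.

Fact dic12_mulA : associative dic12_mul.
Proof.
(* Only - 3 = 3 matters about the constant, so it is generalized for [ring]. *)
rewrite /dic12_mul; move: 3%:R Z6_opp3 => t tN.
by move=> [k [|]] [l [|]] [m [|]]; congr (_, _); rewrite /= ?opprD ?tN; ring.
Qed.

Fact dic12_mul1 : left_id ((0, false) : dic12) dic12_mul.
Proof. by case=> k e; congr (_, _); rewrite /= add0r addr0. Qed.

Fact dic12_mulV : left_inverse ((0, false) : dic12) dic12_inv dic12_mul.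
Proof.
case=> k [|]; congr (_, _); rewrite /= ?addr0 ?addNr //.
by rewrite [_ - k]addrAC subrr add0r; exact: val_inj.
Qed.

HB.instance Definition _ := Finite_isGroup.Build dic12 dic12_mulA dic12_mul1 dic12_mulV.

Section Dic12Morphism.

Variables (T : Type) (mul : T -> T -> T) (p : nat -> T) (y : T).
Hypotheses (mulA : associative mul) (pD : forall m n, p (m + n)%N = mul (p m) (p n)).
Hypotheses (p6 : forall n, p (n + 6)%N = p n) (yy : mul y y = p 3).
Hypothesis yp : forall n, mul y (p n) = mul (p (5 * n)) y.

(** Here [p n] plays the role of a^n and [y] that of b. A bare associative operation is assumed so
    that the map serves both for groups satisfying the presentation and for the multiplication of
    D. *)
Definition dic12_map (u : dic12) : T := if u.2 then mul (p u.1) y else p u.1.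

Lemma dic12_p_mod m n : m = n %[mod 6] -> p m = p n.
Proof.
have pmod k : p k = p (k %% 6).
  rewrite {1}(divn_eq k 6) addnC; elim: (k %/ 6)%N => [|q IH]; first by rewrite mul0n addn0.
  by rewrite mulSnr addnA p6.
by rewrite (pmod m) (pmod n) => ->.
Qed.

Lemma dic12_mapM u v : dic12_map (u * v)%g = mul (dic12_map u) (dic12_map v).
Proof.
have val0 : nat_of_ord (0 : 'Z_6) = 0%N by [].
case: u v => [k [|]] [l [|]].
- rewrite /dic12_map /= -mulA (mulA y) yp -mulA yy -!pD; apply: dic12_p_mod.
  move: (ltn_ord l); rewrite /= -[(Zp_trunc 6).+2]/6%N ?val0; lia.
- rewrite /dic12_map /= -mulA yp mulA -pD; congr (mul _ y); apply: dic12_p_mod.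
  move: (ltn_ord l); rewrite /= -[(Zp_trunc 6).+2]/6%N ?val0; lia.
- rewrite /dic12_map /= mulA -pD; congr (mul _ y); apply: dic12_p_mod.
  move: (ltn_ord l); rewrite /= -[(Zp_trunc 6).+2]/6%N ?val0; lia.
rewrite /dic12_map /= -pD; apply: dic12_p_mod.
move: (ltn_ord l); rewrite /= -[(Zp_trunc 6).+2]/6%N ?val0; lia.
Qed.

End Dic12Morphism.

(** [A] and [B] generate [dic12] and satisfy the relations; conversely, [dic12_map] sends [dic12]
    onto any group generated by two elements satisfying them. *)
Lemma is_Dic12_dic12 : is_Dic12 dic12.
Proof.
pose A : dic12 := (1, false); pose B : dic12 := (0, true).
have AX n : (A ^+ n)%g = (n%:R, false).
  elim: n => // n IH; rewrite expgSr IH; congr (_, _).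
  by rewrite /= addr0 -natr1.
apply: intro_isoGrp => [|rT H].
  apply/existsP; exists (A, B); rewrite /= !xpair_eqE /= eqxx andbT.
  rewrite eqEsubset subsetT; apply/subsetP => -[k e] _.
  have -> : (k, e) = (A ^+ k * B ^+ e)%g :> dic12.
    by rewrite AX; case: e; congr (_, _); rewrite /= ?expg0 ?addr0 natr_Zp.
  by rewrite groupM // groupX // mem_gen // inE cycle_id ?orbT.
case/existsP=> -[x y] /= /eqP[defH x6 yy yx].
pose f := dic12_map mulg (fun n => x ^+ n)%g y.
have yxn n : (y * x ^+ n)%g = (x ^+ (5 * n) * y)%g.
  have x5 : (x ^+ 5 = x^-1)%g by apply: (mulgI x); rewrite -expgS x6 mulgV.
  have yx1 : (y * x = x ^+ 5 * y)%g by rewrite x5 -yx mulgKV.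
  elim: n => [|n IH]; first by rewrite muln0 !expg0 mulg1 mul1g.
  by rewrite expgSr mulgA IH -mulgA yx1 mulgA -expgD mulnS addnC.
have fM : {in [set: dic12] &, {morph f : u v / (u * v)%g}}.
  move=> u v _ _; apply: dic12_mapM => //; first exact: mulgA.
  - by move=> m n; rewrite expgD.
  by move=> n; rewrite expgD x6 mulg1.
apply/homgP; exists (Morphism fM); rewrite -defH; apply/eqP; rewrite eqEsubset.
apply/andP; split.
  apply/subsetP => _ /morphimP[u _ _ ->]; rewrite /= /f /dic12_map.
  have xH : x \in (<[x]> <*> <[y]>)%g by rewrite mem_gen // inE cycle_id.
  have yH : y \in (<[x]> <*> <[y]>)%g by rewrite mem_gen // inE cycle_id orbT.
  by case: u.2; rewrite ?groupM ?groupX.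
rewrite join_subG !cycle_subG; apply/andP; split; apply/morphimP.
  by exists A; rewrite ?inE // /= /f /dic12_map /= expg1.
by exists B; rewrite ?inE // /= /f /dic12_map /= expg0 mul1g.
Qed.

Section Dic12Units.

Variables (D : algType rat) (tr nm : D -> rat) (w y : D).
Hypotheses (H : reduced_trace_norm tr nm) (nw : nm w = 1) (tw : tr w = -1).
Hypotheses (yy : y * y = -1) (yw : y * w = w * w * y).

Let g := 1 + w.

Definition dic12_unit : dic12 -> D := dic12_map *%R (fun n => g ^+ n) y.

Lemma dic12_yg n : y * g ^+ n = g ^+ (5 * n) * y.
Proof.
have yg : y * g = g ^+ 5 * y.
  rewrite (order6_exp5 H nw tw) mulrDr mulr1 yw (order3_sqr H nw tw) mulrBl mul1r mulNr.
  by rewrite addrC subrK.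
elim: n => [|n IH]; first by rewrite muln0 !expr0 mulr1 mul1r.
by rewrite exprSr mulrA IH -mulrA yg mulrA -exprD mulnS addnC.
Qed.

Lemma dic12_unitM u v : dic12_unit (u * v)%g = dic12_unit u * dic12_unit v.
Proof.
apply: dic12_mapM; rewrite ?(order6_exp3 H nw tw) //; first exact: mulrA.
- exact: exprD.
- by move=> n; rewrite exprD (order6_exp6 H nw tw) mulr1.
exact: dic12_yg.
Qed.

(** The kernel is trivial: y does not commute with w and so is no power of g = 1 + w, while g, ...,
    g^5 have traces 1, -1, -2, -1, 1, all different from tr 1 = 2. *)
Lemma dic12_unit_inj : injective dic12_unit.
Proof.
have tr2 x : x = 1 -> tr x = 2 by move=> ->; exact: (rtr1 H).
have yE n : y <> g ^+ n.
  move=> yE; have yw' : y * w = w * y by rewrite -(order6_exp2 H nw tw) yE -!exprD addnC.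
  have ww : w * w = w.
    have : w * w * y * y = w * y * y by rewrite -yw yw'.
    by rewrite -!(mulrA _ y) yy !mulrN1 => /oppr_inj.
  by have := order3_cube H nw tw; rewrite !ww => /tr2; rewrite tw => /eqP; vm_compute.
have ker u : dic12_unit u = 1 -> u = 1%g.
  case: u => k [|]; rewrite /dic12_unit /dic12_map /=.
    move=> /(congr1 ( *%R (g ^+ (6 - k)))); rewrite mulrA -exprD subnK ?(ltnW (ltn_ord k)) //.
    by rewrite (order6_exp6 H nw tw) mul1r mulr1 => /yE.
  move=> /tr2; case: k => [[|[|[|[|[|[|//]]]]]] lt6] /=.
  - by move=> _; congr (_, _); apply: val_inj.
  - by rewrite expr1 (rtrD H) (rtr1 H) tw => /eqP; vm_compute.
  - by rewrite (order6_exp2 H nw tw) tw => /eqP; vm_compute.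
  - by rewrite (order6_exp3 H nw tw) (rtrN H) (rtr1 H) => /eqP; vm_compute.
  - by rewrite (order6_exp4 H nw tw) (rtrB H) (rtrN H) (rtr1 H) tw => /eqP; vm_compute.
  by rewrite (order6_exp5 H nw tw) (rtrN H) tw => /eqP; vm_compute.
have unit1 : dic12_unit 1%g = 1 by [].
move=> u v uv; apply: (mulIg v^-1%g); rewrite mulgV; apply: ker.
by rewrite dic12_unitM uv -dic12_unitM mulgV.
Qed.

Lemma dic12_unit_surj k e : exists u, g ^+ k * y ^+ e = dic12_unit u.
Proof.
(* Every factor y^2 = -1 is absorbed as g^3. *)
pose n := (k + 3 * e./2)%N; exists (inZp n, odd e).
rewrite /dic12_unit /dic12_map /=.
have -> : g ^+ (n %% 6) = g ^+ n.
  by rewrite [in RHS](divn_eq n 6) exprD mulnC exprM (order6_exp6 H nw tw) expr1n mul1r.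
rewrite exprD exprM (order6_exp3 H nw tw) -[in LHS](odd_double_half e) exprD.
rewrite -muln2 mulnC exprM expr2 yy.
have c (x : D) m : x * (-1) ^+ m = (-1) ^+ m * x.
  by rewrite -signr_odd; case: odd; rewrite ?mulN1r ?mulrN1 ?expr0 ?mul1r ?mulr1.
by case: odd; rewrite ?expr1 ?expr0 ?mul1r // c mulrA.
Qed.

End Dic12Units.

(** * The two cases and the conclusion *)

Lemma sum_sqr4 (a b c d : rat) :
  2 * (a ^+ 2 - b ^+ 2 - c ^+ 2 - d ^+ 2) = 2 * a * (2 * a) - 2 ->
  (2 * a) ^+ 2 + (- - (2 * b)) ^+ 2 + (- - (2 * c)) ^+ 2 + (- - (2 * d)) ^+ 2 = 4.
Proof. by rewrite !opprK; lra. Qed.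

Lemma small_intsN (z : int) : z \in small_ints -> - z \in small_ints.
Proof. by rewrite !inE => /or4P[||| /orP[]] /eqP->. Qed.

Lemma mem_small_int4 (x0 x1 x2 x3 : int) : x0 \in small_ints -> x1 \in small_ints ->
  x2 \in small_ints -> x3 \in small_ints -> (x0, x1, x2, x3) \in small_int4.
Proof.
move=> s0 s1 s2 s3; apply/allpairsP; exists ((x0, x1), (x2, x3)); split; last by [].
  by apply/allpairsP; exists (x0, x1).
by apply/allpairsP; exists (x2, x3).
Qed.

Section Cases.

Variables (D : falgType rat) (tr nm : D -> rat) (U : D -> Prop).
Hypotheses (defD : definite_quaternion_algebra D).
Hypotheses (H : reduced_trace_norm tr nm) (gU : unit_group U).

Lemma reduced_trace_norm_inv (x : D) : x != 0 -> exists2 y, y * x = 1 & x * y = 1.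
Proof.
move=> x0; have n0 : nm x != 0 by apply: contra_neq x0 => /(rnm_eq0 H).
have e : tr x *: x - x * x = (nm x)%:A.
  by rewrite (rtrn_sqr H) opprB addrC subrK.
exists ((nm x)^-1 *: ((tr x)%:A - x)).
  by rewrite -scalerAl mulrBl -scalerAl mul1r e scalerA mulVf // scale1r.
by rewrite -scalerAr mulrBr -scalerAr mulr1 e scalerA mulVf // scale1r.
Qed.

Lemma trace_of_sqr (x : D) (c : rat) : nm x = 1 -> x * x = c *: x - 1 -> tr x = c.
Proof.
move=> nx /eqP; rewrite (nm1_sqr H nx) (inj_eq (addIr _)) -subr_eq0 -scalerBl.
rewrite scaler_eq0 subr_eq0 => /orP[/eqP//|/eqP x0].
by move: nx; rewrite x0 -(scale0r (1 : D)) (rnm_scalar H) expr0n.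
Qed.

(** Up to sign the doubled coordinates of u are the traces of u, u i, u j and u i j, which all lie
    in U; so they are integers between -2 and 2, and norm 1 makes their squares add up to 4. *)
Lemma quaternion_pair_hurwitz i j : quaternion_pair U i j ->
  forall u, U u -> exists g, u = hurwitz_unit i j g.
Proof.
case=> Ui Uj ii jj ji u Uu.
have ii' : i ^+ 2 = (-1)%:A by rewrite expr2 ii scaleN1r.
have jj' : j ^+ 2 = (-1)%:A by rewrite expr2 jj scaleN1r.
have bB : basis_of {:D} [:: 1; i; j; i * j].
  by apply: (@definite_quat_basis D i j defD ii ji (-1)); rewrite // scaleN1r.
have tr0 x : U x -> x * x = -1 -> tr x = 0.
  by move=> Ux xx; apply: trace_of_sqr (ug_nm H gU Ux) _; rewrite scale0r add0r.
have kk : i * j * (i * j) = -1.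
  by rewrite !mulrA -(mulrA i j i) ji mulrN mulrA ii mulN1r opprK jj.
have tij := tr0 _ (ugM gU Ui Uj) kk.
have trq x0 x1 x2 x3 : tr (quat i j x0 x1 x2 x3) = 2 * x0.
  rewrite /quat !(rtrD H) !(rtrZ H) (rtr1 H) (tr0 i) // (tr0 j) // tij.
  by rewrite !mulr0 !addr0 mulrC.
have [u0 [u1 [u2 [u3 uE]]]] := quat_span bB u.
have int_tr x : U x -> exists2 z : int, z \in small_ints & tr x = z%:~R.
  move=> /(ug_trace H gU); rewrite !inE => /or4P[||| /orP[]] /eqP->.
  - by exists (-2).
  - by exists (-1).
  - by exists 0.
  - by exists 1.
  by exists 2.
have [n0 s0 e0] := int_tr u Uu; have [n1 s1 e1] := int_tr _ (ugM gU Uu Ui).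
have [n2 s2 e2] := int_tr _ (ugM gU Uu Uj).
have [n3 s3 e3] := int_tr _ (ugM gU Uu (ugM gU Ui Uj)).
have t1 : tr (u * i) = - (2 * u1).
  have -> : u * i = u * quat i j 0 1 0 0 by rewrite -quat_i.
  by rewrite uE (quatM ii' jj' ji) trq; ring.
have t2 : tr (u * j) = - (2 * u2).
  have -> : u * j = u * quat i j 0 0 1 0 by rewrite -quat_j.
  by rewrite uE (quatM ii' jj' ji) trq; ring.
have t3 : tr (u * (i * j)) = - (2 * u3).
  have -> : u * (i * j) = u * quat i j 0 0 0 1 by rewrite -quat_k.
  by rewrite uE (quatM ii' jj' ji) trq; ring.
have t0 : tr u = 2 * u0 by rewrite uE trq.
have sum4 : int4_sqr (n0, - n1, - n2, - n3) = 4.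
  have := congr1 tr (nm1_sqr H (ug_nm H gU Uu)); rewrite (rtrB H) (rtrZ H) (rtr1 H).
  have -> : tr (u * u) = 2 * (u0 ^+ 2 - u1 ^+ 2 - u2 ^+ 2 - u3 ^+ 2).
    by rewrite uE (quatM ii' jj' ji) trq; ring.
  rewrite t0 => sqE; apply: (@intr_inj rat).
  rewrite /int4_sqr !(rmorphD, rmorphXn, rmorphN) /= -e0 -e1 -e2 -e3 t0 t1 t2 t3.
  exact: sum_sqr4.
have [g gE] := hurwitz_unit_surj i j
  (mem_small_int4 s0 (small_intsN s1) (small_intsN s2) (small_intsN s3)) sum4.
exists g; rewrite -gE uE /half_quat !rmorphN /= -e0 -e1 -e2 -e3 t0 t1 t2 t3.
by congr quat; field.
Qed.

(** The element 2 w + 1 is a square root of -3. As y inverts w under conjugation, it negates 2 w + 1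
    = w - w^-1, which exhibits D as (-1, -3). *)
Lemma order3_basis (w y : D) : w * w = - w - 1 -> y * y = -1 -> y * w = w * w * y ->
  (w + w + 1) * (w + w + 1) = (-3)%:A /\ (w + w + 1) * y = - (y * (w + w + 1)).
Proof.
move=> ww yy yw; split.
  pose L p q : D := p *: w + q *: 1.
  have LD p q p' q' : L p q + L p' q' = L (p + p') (q + q').
    by rewrite /L !scalerDl addrACA.
  have L1 : 1 = L 0 1 by rewrite /L scale0r scale1r add0r.
  have Lw : w = L 1 0 by rewrite /L scale0r scale1r addr0.
  have Lww : w * w = L (-1) (-1) by rewrite ww /L !scaleN1r.
  rewrite !mulrDl !mulrDr !mul1r !mulr1 Lww Lw L1 !LD.
  by rewrite /L -[RHS]add0r -[X in _ = X + _](scale0r w); congr (_ *: _ + _ *: _).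
have ywE : y * w = - (w * y) - y by rewrite yw ww mulrBl mulNr mul1r.
rewrite !mulrDl !mulrDr mulr1 mul1r ywE; move: (w * y) => t.
by rewrite !opprD !opprK !addrA addrK addrAC.
Qed.

End Cases.

Theorem theorem4p14 (D : falgType rat) (G : {fset 'M[D]_2}) :
  definite_quaternion_algebra D ->
  maximal_finite_subgroup G ->
  absolutely_irreducible G ->
  imprimitive G ->
  (is_D_p_infty 2 D /\
     group_isomorphic G (wreath_product [subg SL2_F3_group] 2))
  \/
  (is_D_p_infty 3 D /\
     exists2 Dic : finGroupType, is_Dic12 Dic &
       group_isomorphic G (wreath_product Dic 2)).
Proof.
move=> defD maxG spanG impG; have [tr [nm H]] := exists_reduced_trace_norm defD.
have [U gU GU] := imprimitive_unit_group (reduced_trace_norm_inv H) maxG spanG impG.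
have [[i [j ij]]|[w [y [[Uw Uy ww yy yw] expr]]]] := unit_group_dichotomy H gU.
  have [Ui Uj ii jj ji] := ij.
  have ii' : i ^+ 2 = (-1)%:A by rewrite expr2 ii scaleN1r.
  have jj' : j ^+ 2 = (-1)%:A by rewrite expr2 jj scaleN1r.
  left; split; first exact: is_D_2_infty defD ii ji jj.
  apply: (GU _ (hurwitz_unit i j)).
  - exact: (hurwitz_unit_inj ii' jj' ji).
  - exact: (hurwitz_unitM ii' jj' ji).
  exact: (quaternion_pair_hurwitz defD H gU ij).
have nw := ug_nm H gU Uw.
have tw : tr w = -1 by apply: (trace_of_sqr H nw); rewrite scaleN1r.
have [ss sy] := order3_basis ww yy yw.
right; split; first exact: is_D_3_infty defD yy sy ss.
exists dic12; first exact: is_Dic12_dic12.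
apply: (GU _ (dic12_unit w y)).
- exact: (dic12_unit_inj H nw tw yy yw).
- exact: (dic12_unitM H nw tw yy yw).
move=> u /expr[k [e ->]]; exact: (dic12_unit_surj H nw tw yy k e).
Qed.
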